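(* Let $\lambda\ge 1$, $\mu\ge 0$, let $\varphi$ be as in the context with $\varphi(z)=1+B_1z+B_2z^2+\cdots$, and let $f(z)=z+\sum_{n\ge2}a_nz^n$ belong to $\mathcal N^{\mu,\lambda}_\Sigma(\varphi)$. Put $$D:=(2\lambda+\mu)(1+\mu)B_1^2+2(B_1-B_2)(\lambda+\mu)^2,$$ and assume $D\neq 0$. Then for every $\delta\in\mathbb R$, $$|a_3-\delta a_2^2|\le\begin{cases}\dfrac{B_1}{2\lambda+\mu}, & \text{if } |\delta-1|\le \dfrac{\mu+1}{2}\left|1+\dfrac{2(B_1-B_2)(\lambda+\mu)^2}{B_1^2(2\lambda+\mu)(1+\mu)}\right|,\\[3mm] \dfrac{2B_1^3|\delta-1|}{|D|}, & \text{if } |\delta-1|\ge \dfrac{\mu+1}{2}\left|1+\dfrac{2(B_1-B_2)(\lambda+\mu)^2}{B_1^2(2\lambda+\mu)(1+\mu)}\right|.\end{cases}$$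
   Context: Let $\mathbb U=\{z\in\mathbb C:|z|<1\}$ and let $\mathcal A$ be the class of functions $f(z)=z+\sum_{n\ge2}a_nz^n$ analytic in $\mathbb U$. $\Sigma$ denotes the class of bi-univalent functions: $f\in\mathcal A$ univalent in $\mathbb U$ such that the inverse $f^{-1}$ (defined near $0$) extends to an analytic univalent function on $\mathbb U$; this extension is denoted $g=f^{-1}$, and $g(w)=w-a_2w^2+(2a_2^2-a_3)w^3+\cdots$. For $F,G$ analytic in $\mathbb U$, $F\prec G$ (subordination) means there is an analytic $w:\mathbb U\to\mathbb U$ with $w(0)=0$ and $F=G\circ w$. Throughout, $\varphi$ is analytic and univalent in $\mathbb U$ with $\Re\varphi(z)>0$, $\varphi(0)=1$, $\varphi'(0)>0$, $\varphi(\mathbb U)$ starlike with respect to $1$ and symmetric with respect to the real axis, and $\varphi(z)=1+B_1z+B_2z^2+B_3z^3+\cdots$ with all $B_j$ real and $B_1>0$. For $\lambda\ge1$ and $\mu\ge0$, $\mathcal N^{\mu,\lambda}_\Sigma(\varphi)$ is the set of $f\in\Sigma$ such that $$(1-\lambda)\Big(\frac{f(z)}{z}\Big)^{\mu}+\lambda f'(z)\Big(\frac{f(z)}{z}\Big)^{\mu-1}\prec\varphi(z)\quad(z\in\mathbb U)$$ and $$(1-\lambda)\Big(\frac{g(w)}{w}\Big)^{\mu}+\lambda g'(w)\Big(\frac{g(w)}{w}\Big)^{\mu-1}\prec\varphi(w)\quad(w\in\mathbb U),$$ where $g=f^{-1}$ and all powers are principal branches taking the value $1$ at the origin. *)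

(* Defs.v *)
From Stdlib Require Export Reals Lra.
Open Scope R_scope.

Definition C : Type := (R * R)%type.
Definition RtoC (x : R) : C := (x, 0).
Definition C0 : C := (0, 0).
Definition C1 : C := (1, 0).
Definition Cadd (z w : C) : C := (fst z + fst w, snd z + snd w).
Definition Copp (z : C) : C := (- fst z, - snd z).
Definition Csub (z w : C) : C := Cadd z (Copp w).
Definition Cmul (z w : C) : C :=
  (fst z * fst w - snd z * snd w, fst z * snd w + snd z * fst w).
Definition Cinv (z : C) : C :=
  (fst z / (fst z ^ 2 + snd z ^ 2), - snd z / (fst z ^ 2 + snd z ^ 2)).
Definition Cdiv (z w : C) : C := Cmul z (Cinv w).
Definition Cmod (z : C) : R := sqrt (fst z ^ 2 + snd z ^ 2).
Definition Cre (z : C) : R := fst z.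
Definition Cconj (z : C) : C := (fst z, - snd z).
Definition Cexp (z : C) : C := (exp (fst z) * cos (snd z), exp (fst z) * sin (snd z)).
Fixpoint Cpow (z : C) (n : nat) : C :=
  match n with O => C1 | S m => Cmul z (Cpow z m) end.

Definition inU (z : C) : Prop := Cmod z < 1.

Fixpoint Cpsum (a : nat -> C) (z : C) (n : nat) : C :=
  match n with
  | O => a O
  | S m => Cadd (Cpsum a z m) (Cmul (a n) (Cpow z n))
  end.

Definition power_series_on_U (f : C -> C) (a : nat -> C) : Prop :=
  forall z, inU z -> forall eps, eps > 0 ->
    exists N : nat, forall n, (n >= N)%nat -> Cmod (Csub (Cpsum a z n) (f z)) < eps.

Definition Cderiv (f : C -> C) (z d : C) : Prop :=
  forall eps, eps > 0 -> exists del, del > 0 /\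
    forall u, u <> C0 -> Cmod u < del ->
      Cmod (Csub (Cdiv (Csub (f (Cadd z u)) (f z)) u) d) < eps.

Definition deriv_on_U (f f' : C -> C) : Prop := forall z, inU z -> Cderiv f z (f' z).
Definition analytic_on_U (f : C -> C) : Prop := forall z, inU z -> exists d, Cderiv f z d.

Definition univalent_on_U (f : C -> C) : Prop :=
  analytic_on_U f /\ forall z w, inU z -> inU w -> f z = f w -> z = w.

Definition subordinate (F G : C -> C) : Prop :=
  exists w : C -> C, analytic_on_U w /\ (forall z, inU z -> inU (w z)) /\
    w C0 = C0 /\ forall z, inU z -> F z = G (w z).

(* h is the branch of log (F(z)/z) on U with h(0) = 0; then the
   power (F(z)/z)^nu with value 1 at the origin is Cexp (nu * h z). *)
Definition log_quot_branch (F h : C -> C) : Prop :=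
  analytic_on_U h /\ h C0 = C0 /\
  forall z, inU z -> z <> C0 -> Cmul (Cexp (h z)) z = F z.

Definition in_A (f : C -> C) (a : nat -> C) : Prop :=
  a O = C0 /\ a 1%nat = C1 /\ power_series_on_U f a.

Definition inverse_extension (f g : C -> C) : Prop :=
  univalent_on_U g /\ exists r, r > 0 /\ forall z, Cmod z < r -> g (f z) = z.

(* (1-lam) P(z) + lam f'(z) Q(z), with P = (F/z)^mu, Q = (F/z)^(mu-1) *)
Definition Nexpr (lam mu : R) (F' h : C -> C) (z : C) : C :=
  Cadd (Cmul (RtoC (1 - lam)) (Cexp (Cmul (RtoC mu) (h z))))
       (Cmul (RtoC lam) (Cmul (F' z) (Cexp (Cmul (RtoC (mu - 1)) (h z))))).

Definition in_N_Sigma (mu lam : R) (phi f : C -> C) (a : nat -> C) : Prop :=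
  in_A f a /\ univalent_on_U f /\
  exists g f' g' hf hg,
    inverse_extension f g /\
    deriv_on_U f f' /\ deriv_on_U g g' /\
    log_quot_branch f hf /\ log_quot_branch g hg /\
    subordinate (Nexpr lam mu f' hf) phi /\
    subordinate (Nexpr lam mu g' hg) phi.

Definition phi_hyp (phi : C -> C) (B : nat -> R) : Prop :=
  univalent_on_U phi /\
  power_series_on_U phi (fun n => RtoC (B n)) /\
  B O = 1 /\ B 1%nat > 0 /\
  (forall z, inU z -> Cre (phi z) > 0) /\
  (forall z t, inU z -> 0 <= t <= 1 ->
     exists w, inU w /\ phi w = Cadd C1 (Cmul (RtoC t) (Csub (phi z) C1))) /\
  (forall z, inU z -> exists w, inU w /\ phi w = Cconj (phi z)).

(* Main.v *)
From Stdlib Require Import Lia Lra.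
From Coquelicot Require Import Coquelicot.
Require Import Defs.
Set Bullet Behavior "Strict Subproofs".

(** Write the two subordinations with Schwarz functions
    [u = u1 z + u2 z^2 + ...] and [v = v1 w + v2 w^2 + ...], and put
    [P = u2 + u1^2], [Q = v2 + v1^2].  Comparing coefficients up to order two gives
    [D a2^2 = B1^3 (P + Q)] and [2 (2 lam + mu) (a3 - a2^2) = B1 (P - Q)], so that
    [a3 - delta a2^2 = k (P - Q) + h (P + Q)] with [k = B1 / (2 (2 lam + mu))] and
    [h = (1 - delta) B1^3 / D].  As [2 P] is the second coefficient of the function
    [(1 + u) / (1 - u)] of positive real part, Caratheodory's inequality gives
    [|P| <= 1], likewise [|Q| <= 1], and the modulus is at most
    [|h + k| + |h - k| = 2 max (|h|, k)].

    Analyticity means only that a complex derivative exists at each point of the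
    disc, so Caratheodory's inequality rests on a Goursat bisection argument:
    circle means of a function analytic in the punctured disc do not depend on the
    radius.  All Taylor expansions used are local, of order two at the origin. *)

(** * Goursat's theorem on rectangles *)

(** The shape of [D] comes from writing [u2 = P - u1^2]. The second coefficient of [phi o u] is
    [B1 u2 + B2 u1^2 = B1 P - (B1 - B2) u1^2], and the first one gives [B1 u1 = (lam + mu) a2];
    eliminating [u1] produces the term with [(B1 - B2) (lam + mu)^2]. The inverse function obeys the
    same relations with [(a2, a3)] replaced by [(- a2, 2 a2^2 - a3)], so the sum isolates [a2^2] and
    the difference isolates [a3 - a2^2].

    The obstacle is that [g], the logarithm branches and the Schwarz functions come only with
    pointwise derivatives, not with power series. Their coefficients are read off from identities
    [F z = c0 + c1 z + k(z) z^2] with [k] continuous at [0]; such expansions pass through sums,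
    products and composition, and an outer function with nonzero derivative at the origin can be
    cancelled. The bound on [P] compares one circle with arbitrarily small ones; in the coordinate
    [log z] the annulus between them is a rectangle, the shape on which bisection works. *)

Lemma nested_segments (x l : nat -> R) :
  (forall n, 0 <= l n) ->
  (forall n, x n <= x (S n) /\ x (S n) + l (S n) <= x n + l n) ->
  exists X, forall n, x n <= X <= x n + l n.
Proof.
  intros Hl Hx.
  assert (Hup : forall n k, x n <= x (n + k)%nat).
  { intros n k; induction k as [|k IH].
    - rewrite Nat.add_0_r; lra.
    - rewrite Nat.add_succ_r; specialize (Hx (n + k)%nat); lra. }
  assert (Hdn : forall n k, x (n + k)%nat + l (n + k)%nat <= x n + l n).
  { intros n k; induction k as [|k IH].
    - rewrite Nat.add_0_r; lra.
    - rewrite Nat.add_succ_r; specialize (Hx (n + k)%nat); lra. }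
  assert (Hub : forall m n, x m <= x n + l n).
  { intros m n.
    specialize (Hup m n); specialize (Hdn n m); specialize (Hl (m + n)%nat).
    rewrite (Nat.add_comm n m) in Hdn; lra. }
  (* The common point is the supremum of the left ends; every right end is an upper bound for
     them. *)
  destruct (completeness (fun r => exists n, r = x n)) as [X [HX1 HX2]].
  - exists (x O + l O); intros r [n ->]; apply Hub.
  - exists (x O); exists O; reflexivity.
  - exists X; intros n; split.
    + apply HX1; exists n; reflexivity.
    + apply HX2; intros r [m ->]; apply Hub.
Qed.

(** The common [m] says that the [y]-derivative of [P] equals the [x]-derivative of [Q] at the
    point. Both functions are totally differentiable there and nothing is said about continuity of
    the partial derivatives, so bisection takes the place of Green's formula. *)
Definition closed_form (P Q : R -> R -> R) (x y : R) : Prop :=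
  exists px m qy, differentiable_pt_lim P x y px m /\ differentiable_pt_lim Q x y m qy.

(* The integral of [P dx + Q dy] along the boundary of the rectangle
   [[x, x+L] x [y, y+H]], with opposite sides grouped together. *)
Definition rect_int (P Q : R -> R -> R) (x y L H : R) : R :=
  RInt (fun s => P s y - P s (y + H)) x (x + L) +
  RInt (fun t => Q (x + L) t - Q x t) y (y + H).

Lemma differentiable_continuous_l (f : R -> R -> R) (x y lx ly : R) :
  differentiable_pt_lim f x y lx ly -> continuous (fun s => f s y) x.
Proof.
  intros Hf.
  apply (ex_derive_continuous (fun s => f s y)).
  exists (lx * 1 + ly * 0); apply is_derive_Reals.
  apply (derivable_pt_lim_comp_2d f (fun s => s) (fun _ => y) x lx ly 1 0 Hf).
  - apply derivable_pt_lim_id.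
  - apply derivable_pt_lim_const.
Qed.

Lemma differentiable_continuous_r (f : R -> R -> R) (x y lx ly : R) :
  differentiable_pt_lim f x y lx ly -> continuous (fun t => f x t) y.
Proof.
  intros Hf.
  apply (ex_derive_continuous (fun t => f x t)).
  exists (lx * 0 + ly * 1); apply is_derive_Reals.
  apply (derivable_pt_lim_comp_2d f (fun _ => x) (fun t => t) y lx ly 0 1 Hf).
  - apply derivable_pt_lim_const.
  - apply derivable_pt_lim_id.
Qed.

Lemma closed_form_ex_RInt_l (P Q : R -> R -> R) (x y L : R) :
  0 <= L -> (forall s, x <= s <= x + L -> closed_form P Q s y) ->
  ex_RInt (fun s => P s y) x (x + L).
Proof.
  intros HL Hc; apply (ex_RInt_continuous (V := R_CompleteNormedModule)); intros s Hs.
  rewrite Rmin_left, Rmax_right in Hs by lra.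
  destruct (Hc s Hs) as (px & m & qy & HP & _).
  exact (differentiable_continuous_l _ _ _ _ _ HP).
Qed.

Lemma closed_form_ex_RInt_r (P Q : R -> R -> R) (x y H : R) :
  0 <= H -> (forall t, y <= t <= y + H -> closed_form P Q x t) ->
  ex_RInt (fun t => Q x t) y (y + H).
Proof.
  intros HH Hc; apply (ex_RInt_continuous (V := R_CompleteNormedModule)); intros s Hs.
  rewrite Rmin_left, Rmax_right in Hs by lra.
  destruct (Hc s Hs) as (px & m & qy & _ & HQ).
  exact (differentiable_continuous_r _ _ _ _ _ HQ).
Qed.

Definition closed_on (P Q : R -> R -> R) (x y L H : R) : Prop :=
  forall s t, x <= s <= x + L -> y <= t <= y + H -> closed_form P Q s t.

(** The grouped form suits the estimate near a point; the four separate sides suit additivity and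
    periodicity. *)
Lemma rect_int_split (P Q : R -> R -> R) (x y L H : R) :
  0 <= L -> 0 <= H -> closed_on P Q x y L H ->
  rect_int P Q x y L H =
  RInt (fun s => P s y) x (x + L) - RInt (fun s => P s (y + H)) x (x + L) +
  (RInt (fun t => Q (x + L) t) y (y + H) - RInt (fun t => Q x t) y (y + H)).
Proof.
  intros HL HH Hc; unfold rect_int.
  assert (HP : forall t, y <= t <= y + H -> ex_RInt (fun s => P s t) x (x + L)).
  { intros; apply (closed_form_ex_RInt_l P Q); trivial; intros; apply Hc; lra. }
  assert (HQ : forall s, x <= s <= x + L -> ex_RInt (fun t => Q s t) y (y + H)).
  { intros; apply (closed_form_ex_RInt_r P Q); trivial; intros; apply Hc; lra. }
  rewrite (RInt_minus (V := R_CompleteNormedModule) (fun s => P s y) (fun s => P s (y + H)))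
    by (apply HP; lra).
  rewrite (RInt_minus (V := R_CompleteNormedModule) (fun t => Q (x + L) t) (fun t => Q x t))
    by (apply HQ; lra).
  reflexivity.
Qed.

(** Each inner side is traversed twice in opposite directions and cancels. *)
Lemma rect_int_quarter (P Q : R -> R -> R) (x y L H : R) :
  0 <= L -> 0 <= H -> closed_on P Q x y (2 * L) (2 * H) ->
  rect_int P Q x y (2 * L) (2 * H) =
  rect_int P Q x y L H + rect_int P Q (x + L) y L H +
  rect_int P Q x (y + H) L H + rect_int P Q (x + L) (y + H) L H.
Proof.
  intros HL HH Hc.
  assert (HP : forall t, y <= t <= y + 2 * H ->
    RInt (fun s => P s t) x (x + 2 * L) =
    RInt (fun s => P s t) x (x + L) + RInt (fun s => P s t) (x + L) (x + L + L)).
  { intros t Ht; replace (x + 2 * L) with (x + L + L) by ring.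
    symmetry; apply (RInt_Chasles (V := R_CompleteNormedModule));
      apply (closed_form_ex_RInt_l P Q); try assumption; intros; apply Hc; lra. }
  assert (HQ : forall s, x <= s <= x + 2 * L ->
    RInt (fun t => Q s t) y (y + 2 * H) =
    RInt (fun t => Q s t) y (y + H) + RInt (fun t => Q s t) (y + H) (y + H + H)).
  { intros t Ht; replace (y + 2 * H) with (y + H + H) by ring.
    symmetry; apply (RInt_Chasles (V := R_CompleteNormedModule));
      apply (closed_form_ex_RInt_r P Q); try assumption; intros; apply Hc; lra. }
  rewrite !rect_int_split; try lra; try (intros s t Hs Ht; apply Hc; lra).
  rewrite !HP, !HQ by lra.
  replace (x + L + L) with (x + 2 * L) by ring.
  replace (y + H + H) with (y + 2 * H) by ring.
  ring.
Qed.

(** The affine part of the form integrates to zero: its two pairs of sides contribute [- m L H] and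
    [m L H], with the same [m] by closedness. On each side the remainder is at most
    [e / 2 * (L + H)]; two sides of length [L] and two of length [H] add up to [e (L + H)^2]. *)
Lemma rect_int_small (P Q : R -> R -> R) (X Y : R) :
  closed_form P Q X Y -> forall e, 0 < e -> exists d, 0 < d /\
  forall x y L H, 0 <= L < d -> 0 <= H < d -> x <= X <= x + L -> y <= Y <= y + H ->
    closed_on P Q x y L H ->
    Rabs (rect_int P Q x y L H) <= e * (L + H) ^ 2.
Proof.
  intros (px & m & qy & HP & HQ) e He.
  assert (He2 : 0 < e / 2) by lra.
  destruct (HP (mkposreal _ He2)) as [d1 Hd1].
  destruct (HQ (mkposreal _ He2)) as [d2 Hd2].
  simpl in Hd1, Hd2.
  exists (Rmin d1 d2); split.
  { apply Rmin_pos; [apply d1 | apply d2]. }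
  intros x y L H HL HH HX HY Hc.
  pose proof (Rmin_l d1 d2); pose proof (Rmin_r d1 d2).
  assert (Hin : forall u v, x <= u <= x + L -> y <= v <= y + H ->
    Rabs (u - X) <= L /\ Rabs (v - Y) <= H /\ Rmax (Rabs (u - X)) (Rabs (v - Y)) <= L + H).
  { intros u v Hu Hv.
    assert (Rabs (u - X) <= L) by (apply Rabs_le; lra).
    assert (Rabs (v - Y) <= H) by (apply Rabs_le; lra).
    split; [|split]; trivial; apply Rmax_lub; lra. }
  assert (EP : forall u v, x <= u <= x + L -> y <= v <= y + H ->
     Rabs (P u v - P X Y - (px * (u - X) + m * (v - Y))) <= e / 2 * (L + H)).
  { intros u v Hu Hv; destruct (Hin u v Hu Hv) as (I1 & I2 & I3).
    eapply Rle_trans; [apply Hd1; lra|].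
    apply Rmult_le_compat_l; lra. }
  assert (EQ : forall u v, x <= u <= x + L -> y <= v <= y + H ->
     Rabs (Q u v - Q X Y - (m * (u - X) + qy * (v - Y))) <= e / 2 * (L + H)).
  { intros u v Hu Hv; destruct (Hin u v Hu Hv) as (I1 & I2 & I3).
    eapply Rle_trans; [apply Hd2; lra|].
    apply Rmult_le_compat_l; lra. }
  assert (KP : Rabs (RInt (fun s => P s y - P s (y + H)) x (x + L) - L * (- (m * H))) <= L * (e * (L + H))).
  { assert (Hex : ex_RInt (V := R_NormedModule) (fun s => P s y - P s (y + H)) x (x + L)).
    { apply (ex_RInt_minus (V := R_NormedModule) (fun s => P s y) (fun s => P s (y + H)));
        apply (closed_form_ex_RInt_l P Q); try lra; intros; apply Hc; lra. }
    replace (L * (- (m * H))) with (RInt (fun _ => - (m * H)) x (x + L))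
      by (rewrite RInt_const; unfold scal; simpl; unfold mult; simpl; ring).
    rewrite <- (RInt_minus (V := R_CompleteNormedModule)); [|exact Hex|apply ex_RInt_const].
    replace L with (x + L - x) at 2 by ring.
    apply abs_RInt_le_const; [lra| |].
    - apply (ex_RInt_minus (V := R_NormedModule)); [exact Hex|apply ex_RInt_const].
    - intros s Hs.
      pose proof (EP s y Hs ltac:(lra)) as E1.
      pose proof (EP s (y + H) Hs ltac:(lra)) as E2.
      apply Rabs_le_between in E1; apply Rabs_le_between in E2.
      unfold minus, plus, opp; simpl.
      apply Rabs_le; split; lra. }
  assert (KQ : Rabs (RInt (fun t => Q (x + L) t - Q x t) y (y + H) - H * (m * L)) <= H * (e * (L + H))).
  { assert (Hex : ex_RInt (V := R_NormedModule) (fun t => Q (x + L) t - Q x t) y (y + H)).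
    { apply (ex_RInt_minus (V := R_NormedModule) (fun t => Q (x + L) t) (fun t => Q x t));
        apply (closed_form_ex_RInt_r P Q); try lra; intros; apply Hc; lra. }
    replace (H * (m * L)) with (RInt (fun _ => m * L) y (y + H))
      by (rewrite RInt_const; unfold scal; simpl; unfold mult; simpl; ring).
    rewrite <- (RInt_minus (V := R_CompleteNormedModule)); [|exact Hex|apply ex_RInt_const].
    replace H with (y + H - y) at 2 by ring.
    apply abs_RInt_le_const; [lra| |].
    - apply (ex_RInt_minus (V := R_NormedModule)); [exact Hex|apply ex_RInt_const].
    - intros t Ht.
      pose proof (EQ (x + L) t ltac:(lra) Ht) as E1.
      pose proof (EQ x t ltac:(lra) Ht) as E2.
      apply Rabs_le_between in E1; apply Rabs_le_between in E2.
      unfold minus, plus, opp; simpl.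
      apply Rabs_le; split; lra. }
  unfold rect_int.
  apply Rabs_le_between in KP; apply Rabs_le_between in KQ.
  apply Rabs_le; split; lra.
Qed.

(* Goursat's bisection, for a merely differentiable closed form. *)
Lemma goursat_rect (P Q : R -> R -> R) (x y L H : R) :
  0 <= L -> 0 <= H -> closed_on P Q x y L H -> rect_int P Q x y L H = 0.
Proof.
  intros HL HH Hc.
  set (J := fun (q : R * R) (n : nat) => Rabs (rect_int P Q (fst q) (snd q) (L / 2 ^ n) (H / 2 ^ n))).
  (* The quarter kept is one whose integral is at least a quarter of the current one in modulus. The
     last alternative needs no test: the four integrals sum to the current one, so they cannot all
     fall below that threshold. *)
  set (step := fun (q : R * R) (n : nat) =>
    let l := L / 2 ^ S n in let h := H / 2 ^ S n in let (a, b) := q in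
    if Rle_dec (J q n) (4 * J (a, b) (S n)) then (a, b) else
    if Rle_dec (J q n) (4 * J (a + l, b) (S n)) then (a + l, b) else
    if Rle_dec (J q n) (4 * J (a, b + h) (S n)) then (a, b + h) else (a + l, b + h)).
  set (q := fix q n := match n with O => (x, y) | S m => step (q m) m end).
  assert (Hpow : forall n, 0 < 2 ^ n) by (intros; apply pow_lt; lra).
  assert (Hl : forall n, 0 <= L / 2 ^ n /\ 0 <= H / 2 ^ n).
  { intros n; split; apply Rdiv_le_0_compat; auto. }
  assert (H2 : forall n, L / 2 ^ n = 2 * (L / 2 ^ S n) /\ H / 2 ^ n = 2 * (H / 2 ^ S n)).
  { intros n; specialize (Hpow n); simpl; split; field; lra. }
  assert (Hstep : forall p n,
    (fst p <= fst (step p n) /\ fst (step p n) + L / 2 ^ S n <= fst p + L / 2 ^ n) /\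
    (snd p <= snd (step p n) /\ snd (step p n) + H / 2 ^ S n <= snd p + H / 2 ^ n)).
  { intros [a b] n; specialize (H2 n); specialize (Hl (S n)).
    unfold step; repeat destruct Rle_dec; cbn [fst snd]; lra. }
  destruct (nested_segments (fun n => fst (q n)) (fun n => L / 2 ^ n)) as [X HX].
  { intros n; apply Hl. }
  { intros n; apply (Hstep (q n) n). }
  destruct (nested_segments (fun n => snd (q n)) (fun n => H / 2 ^ n)) as [Y HY].
  { intros n; apply Hl. }
  { intros n; apply (Hstep (q n) n). }
  assert (Hsub : forall n, x <= fst (q n) /\ fst (q n) + L / 2 ^ n <= x + L /\
                           y <= snd (q n) /\ snd (q n) + H / 2 ^ n <= y + H).
  { induction n as [|n IH].
    - simpl; lra.
    - specialize (Hstep (q n) n); change (q (S n)) with (step (q n) n); lra. }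
  assert (Hcl : forall n, closed_on P Q (fst (q n)) (snd (q n)) (L / 2 ^ n) (H / 2 ^ n)).
  { intros n s t Hs Ht; specialize (Hsub n); apply Hc; lra. }
  assert (HJ : forall n, J (q O) O <= 4 ^ n * J (q n) n).
  { induction n as [|n IH]; [simpl; lra|].
    assert (HS : J (q n) n <= 4 * J (step (q n) n) (S n)).
    { specialize (Hcl n); unfold step.
      destruct (q n) as [a b] eqn:Eq.
      do 3 (destruct Rle_dec; [assumption|]).
      destruct (H2 n) as [E1 E2]; destruct (Hl (S n)) as [G1 G2].
      assert (T : J (a, b) n <= J (a, b) (S n) + J (a + L / 2 ^ S n, b) (S n) +
         J (a, b + H / 2 ^ S n) (S n) + J (a + L / 2 ^ S n, b + H / 2 ^ S n) (S n)).
      { cbn [fst snd] in Hcl; rewrite E1, E2 in Hcl.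
        unfold J at 1; cbn [fst snd]; rewrite E1, E2, rect_int_quarter by assumption.
        eapply Rle_trans; [apply Rabs_triang|]; apply Rplus_le_compat_r.
        eapply Rle_trans; [apply Rabs_triang|]; apply Rplus_le_compat_r.
        apply Rabs_triang. }
      lra. }
    change (q (S n)) with (step (q n) n).
    eapply Rle_trans; [apply IH|].
    replace (4 ^ S n * J (step (q n) n) (S n)) with (4 ^ n * (4 * J (step (q n) n) (S n)))
      by (simpl; ring).
    apply Rmult_le_compat_l; [apply pow_le; lra | assumption]. }
  destruct (Req_dec (rect_int P Q x y L H) 0) as [|Hne]; [assumption|exfalso].
  assert (Hpos : 0 < J (q O) O).
  { unfold J; simpl; rewrite !Rdiv_1_r; apply Rabs_pos_lt; assumption. }
  assert (HXY : closed_form P Q X Y).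
  { apply Hc; specialize (HX O); specialize (HY O); simpl in HX, HY; lra. }
  (* With this [e] the bound [e (L + H)^2] is less than half of the initial integral; the [+ 1]
     covers a rectangle reduced to a point. The factor [4 ^ N] lost in the selection is compensated
     exactly by the squared size of the [N]-th rectangle. *)
  set (e := J (q O) O / (2 * ((L + H) ^ 2 + 1))).
  assert (HLH : 0 < 2 * ((L + H) ^ 2 + 1)) by nra.
  destruct (rect_int_small P Q X Y HXY e) as (d & Hd & Hsmall).
  { apply Rdiv_lt_0_compat; assumption. }
  destruct (pow_lt_1_zero (/ 2)) with (y := d / (L + H + 1)) as [N HN].
  { rewrite Rabs_right; lra. }
  { apply Rdiv_lt_0_compat; lra. }
  specialize (HN N (le_n N)).
  rewrite pow_inv, Rabs_right in HN
    by (apply Rle_ge, Rlt_le, Rinv_0_lt_compat, Hpow).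
  assert (Hlt : (L + H + 1) / 2 ^ N < d).
  { apply (Rmult_lt_compat_l (L + H + 1)) in HN; [|lra].
    unfold Rdiv at 1; eapply Rlt_le_trans; [exact HN|].
    right; field; lra. }
  assert (HLN : L / 2 ^ N < d /\ H / 2 ^ N < d).
  { pose proof (Rinv_0_lt_compat _ (Hpow N)); unfold Rdiv in *; split; nra. }
  specialize (Hsmall (fst (q N)) (snd (q N)) (L / 2 ^ N) (H / 2 ^ N)).
  specialize (Hsmall ltac:(split; [apply Hl|apply HLN]) ltac:(split; [apply Hl|apply HLN])).
  specialize (Hsmall (HX N) (HY N) (Hcl N)).
  specialize (HJ N); change (Rabs _) with (J (q N) N) in Hsmall.
  assert (Hle : J (q O) O <= e * (L + H) ^ 2).
  { eapply Rle_trans; [exact HJ|].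
    eapply Rle_trans; [apply Rmult_le_compat_l; [apply pow_le; lra|exact Hsmall]|].
    right; replace 4 with (2 * 2) by ring; rewrite Rpow_mult_distr.
    field; apply Rgt_not_eq, Hpow. }
  unfold e in Hle.
  assert (J (q O) O * (2 * ((L + H) ^ 2 + 1)) <= J (q O) O * (L + H) ^ 2).
  { apply (Rmult_le_compat_r (2 * ((L + H) ^ 2 + 1))) in Hle; [|lra].
    eapply Rle_trans; [exact Hle|]; right; field; nra. }
  nra.
Qed.

(** * Complex derivatives and second-order expansions at the origin *)

Declare Scope cpl_scope.
Delimit Scope cpl_scope with cpl.
Infix "+" := Cadd : cpl_scope.
Infix "-" := Csub : cpl_scope.
Infix "*" := Cmul : cpl_scope.
Infix "/" := Cdiv : cpl_scope.
Notation "- z" := (Copp z) : cpl_scope.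
Notation "/ z" := (Cinv z) : cpl_scope.

(** The concrete operations are convertible with those of [Complex], so its field structure and its
    facts on the modulus carry over by conversion. *)
Lemma C_field : field_theory C0 C1 Cadd Cmul Csub Copp Cdiv Cinv eq.
Proof. exact Complex.C_field_theory. Qed.

Add Field C_field_instance : C_field.

Lemma Cmod_nonneg (z : C) : 0 <= Cmod z.
Proof. exact (Complex.Cmod_ge_0 z). Qed.

Lemma Cmod_add_le (z w : C) : Cmod (z + w)%cpl <= Cmod z + Cmod w.
Proof. exact (Complex.Cmod_triangle z w). Qed.

Lemma Cmod_mul (z w : C) : Cmod (z * w)%cpl = Cmod z * Cmod w.
Proof. exact (Complex.Cmod_mult z w). Qed.

Lemma Cmod_copp (z : C) : Cmod (- z)%cpl = Cmod z.
Proof. exact (Complex.Cmod_opp z). Qed.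

Lemma Cmod_cinv (z : C) : z <> C0 -> Cmod (/ z)%cpl = / Cmod z.
Proof. exact (Complex.Cmod_inv z). Qed.

Lemma Cmod_C0 : Cmod C0 = 0.
Proof. exact Complex.Cmod_0. Qed.

Lemma Cmod_C1 : Cmod C1 = 1.
Proof. exact Complex.Cmod_1. Qed.

Lemma Cmod_RtoC (x : R) : Cmod (RtoC x) = Rabs x.
Proof. exact (Complex.Cmod_R x). Qed.

Lemma Cmod_pos (z : C) : z <> C0 -> 0 < Cmod z.
Proof. exact (proj1 (Complex.Cmod_gt_0 z)). Qed.

Lemma Cmod_zero (z : C) : Cmod z = 0 -> z = C0.
Proof. exact (Complex.Cmod_eq_0 z). Qed.

Lemma Cmod_sqr (z : C) : Cmod z ^ 2 = fst z ^ 2 + snd z ^ 2.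
Proof. exact (Complex.Cmod2_alt z). Qed.

Lemma Cmod_sub_le (z w : C) : Cmod (z - w)%cpl <= Cmod z + Cmod w.
Proof. unfold Csub; rewrite <- (Cmod_copp w); apply Cmod_add_le. Qed.

Lemma Cmod_sub_sym (z w : C) : Cmod (z - w)%cpl = Cmod (w - z)%cpl.
Proof. rewrite <- Cmod_copp; f_equal; ring. Qed.

Lemma C_eq_dec (z w : C) : {z = w} + {z <> w}.
Proof.
  destruct z as [x y], w as [x' y'].
  destruct (Req_EM_T x x') as [->|Hx]; [destruct (Req_EM_T y y') as [->|Hy]|].
  - left; reflexivity.
  - right; congruence.
  - right; congruence.
Qed.

Lemma Cmul_integral (z w : C) : (z * w)%cpl = C0 -> z <> C0 -> w = C0.
Proof.
  intros H Hz; replace w with (/ z * (z * w))%cpl by (field; exact Hz).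
  rewrite H; ring.
Qed.

Lemma C1_neq_C0 : C1 <> C0.
Proof. intros H; injection H; lra. Qed.

Lemma RtoC_neq_C0 (x : R) : x <> 0 -> RtoC x <> C0.
Proof. intros Hx H; injection H; exact Hx. Qed.

Lemma RtoC_add (x y : R) : RtoC (x + y) = (RtoC x + RtoC y)%cpl.
Proof. exact (Complex.RtoC_plus x y). Qed.

Lemma RtoC_sub (x y : R) : RtoC (x - y) = (RtoC x - RtoC y)%cpl.
Proof. exact (Complex.RtoC_minus x y). Qed.

Lemma RtoC_mul (x y : R) : RtoC (x * y) = (RtoC x * RtoC y)%cpl.
Proof. exact (Complex.RtoC_mult x y). Qed.

(** * Neighbourhoods of the origin and continuity there *)

Definition near0 (A : C -> Prop) : Prop :=
  exists del, del > 0 /\ forall z, Cmod z < del -> A z.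

Lemma near0_and (A B : C -> Prop) : near0 A -> near0 B -> near0 (fun z => A z /\ B z).
Proof.
  intros (d & Hd & HA) (e & He & HB); exists (Rmin d e); split.
  - apply Rmin_pos; assumption.
  - intros z Hz; pose proof (Rmin_l d e); pose proof (Rmin_r d e).
    split; [apply HA | apply HB]; lra.
Qed.

Lemma near0_imp (A B : C -> Prop) : (forall z, A z -> B z) -> near0 A -> near0 B.
Proof. intros H (d & Hd & HA); exists d; auto. Qed.

Lemma near0_at (A : C -> Prop) : near0 A -> A C0.
Proof. intros (d & Hd & HA); apply HA; rewrite Cmod_C0; lra. Qed.

Lemma near0_inU : near0 inU.
Proof. exists 1; split; [lra|trivial]. Qed.

Definition cont0 (k : C -> C) : Prop :=
  forall eps, eps > 0 -> near0 (fun z => Cmod (k z - k C0)%cpl < eps).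

Lemma near0_comp (A : C -> Prop) (F : C -> C) :
  cont0 F -> F C0 = C0 -> near0 A -> near0 (fun z => A (F z)).
Proof.
  intros HF H0 (d & Hd & HA); generalize (HF d Hd); apply near0_imp.
  intros z Hz; apply HA; rewrite H0 in Hz.
  replace (F z) with (F z - C0)%cpl by ring; exact Hz.
Qed.

Lemma cont0_ext (F G : C -> C) : near0 (fun z => F z = G z) -> cont0 F -> cont0 G.
Proof.
  intros He HF eps Heps; rewrite <- (near0_at _ He).
  generalize (near0_and _ _ He (HF eps Heps)); apply near0_imp.
  intros z [<- H]; exact H.
Qed.

Lemma cont0_const (c : C) : cont0 (fun _ => c).
Proof.
  intros eps Heps; exists 1; split; [lra|]; intros z _.
  replace (c - c)%cpl with C0 by ring; rewrite Cmod_C0; exact Heps.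
Qed.

Lemma cont0_id : cont0 (fun z => z).
Proof.
  intros eps Heps; exists eps; split; [lra|]; intros z Hz.
  replace (z - C0)%cpl with z by ring; exact Hz.
Qed.

Lemma cont0_add (F G : C -> C) : cont0 F -> cont0 G -> cont0 (fun z => F z + G z)%cpl.
Proof.
  intros HF HG eps Heps.
  generalize (near0_and _ _ (HF (eps / 2) ltac:(lra)) (HG (eps / 2) ltac:(lra))).
  apply near0_imp; intros z [H1 H2].
  replace (F z + G z - (F C0 + G C0))%cpl with ((F z - F C0) + (G z - G C0))%cpl by ring.
  eapply Rle_lt_trans; [apply Cmod_add_le|lra].
Qed.

Lemma cont0_mul (F G : C -> C) : cont0 F -> cont0 G -> cont0 (fun z => F z * G z)%cpl.
Proof.
  intros HF HG eps Heps.
  pose proof (Cmod_nonneg (F C0)) as Pf; pose proof (Cmod_nonneg (G C0)) as Pg.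
  set (M := 1 + Cmod (F C0) + Cmod (G C0)).
  assert (HM : 0 < M) by (unfold M; lra).
  set (e := Rmin 1 (eps / M)).
  assert (He : e > 0) by (apply Rmin_pos; [lra|apply Rdiv_lt_0_compat; lra]).
  assert (He1 : e <= 1) by apply Rmin_l.
  assert (HeM : e * M <= eps).
  { replace eps with (eps / M * M) by (field; lra).
    apply Rmult_le_compat_r; [lra|apply Rmin_r]. }
  generalize (near0_and _ _ (HF e He) (HG e He)).
  apply near0_imp; intros z [H1 H2].
  replace (F z * G z - F C0 * G C0)%cpl
    with ((F z - F C0) * (G z - G C0) + (F C0 * (G z - G C0) + G C0 * (F z - F C0)))%cpl by ring.
  eapply Rle_lt_trans; [apply Cmod_add_le|].
  eapply Rle_lt_trans; [apply Rplus_le_compat_l, Cmod_add_le|].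
  rewrite !Cmod_mul.
  pose proof (Cmod_nonneg (F z - F C0)%cpl); pose proof (Cmod_nonneg (G z - G C0)%cpl).
  unfold M in HeM; nra.
Qed.

Lemma cont0_opp (F : C -> C) : cont0 F -> cont0 (fun z => - F z)%cpl.
Proof.
  intros HF; eapply cont0_ext; [|exact (cont0_mul _ _ (cont0_const (- C1)%cpl) HF)].
  exists 1; split; [lra|]; intros; ring.
Qed.

Lemma cont0_sub (F G : C -> C) : cont0 F -> cont0 G -> cont0 (fun z => F z - G z)%cpl.
Proof. intros HF HG; apply cont0_add; [|apply cont0_opp]; assumption. Qed.

Lemma cont0_near_half (F : C -> C) : cont0 F -> F C0 <> C0 ->
  near0 (fun z => Cmod (F C0) / 2 < Cmod (F z)).
Proof.
  intros HF H0; pose proof (Cmod_pos _ H0) as Hp.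
  generalize (HF (Cmod (F C0) / 2) ltac:(lra)); apply near0_imp; intros z Hz.
  assert (Cmod (F C0) <= Cmod (F C0 - F z)%cpl + Cmod (F z)).
  { replace (F C0) with ((F C0 - F z) + F z)%cpl at 1 by ring; apply Cmod_add_le. }
  rewrite Cmod_sub_sym in Hz; lra.
Qed.

Lemma cont0_near_neq (F : C -> C) : cont0 F -> F C0 <> C0 -> near0 (fun z => F z <> C0).
Proof.
  intros HF H0; generalize (cont0_near_half F HF H0); apply near0_imp; intros z Hz E.
  rewrite E, Cmod_C0 in Hz; pose proof (Cmod_nonneg (F C0)); lra.
Qed.

Lemma cont0_inv (F : C -> C) : cont0 F -> F C0 <> C0 -> cont0 (fun z => / F z)%cpl.
Proof.
  intros HF H0 eps Heps.
  pose proof (Cmod_pos _ H0) as Hp.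
  set (m := Cmod (F C0)) in *.
  assert (He : eps * (m * m / 2) > 0) by (apply Rmult_lt_0_compat; [lra|nra]).
  generalize (near0_and _ _ (near0_and _ _ (cont0_near_half F HF H0) (cont0_near_neq F HF H0))
                            (HF _ He)).
  apply near0_imp; intros z [[H1 H2] H3]; fold m in H1.
  replace (/ F z - / F C0)%cpl with ((F C0 - F z) * / (F z * F C0))%cpl by (field; auto).
  rewrite Cmod_mul, Cmod_sub_sym, Cmod_cinv, Cmod_mul; fold m.
  2: { intros E; apply H0; apply (Cmul_integral _ _ E H2). }
  assert (Hq : m * m / 2 < Cmod (F z) * m) by nra.
  apply (Rmult_lt_reg_r (Cmod (F z) * m)); [nra|].
  rewrite Rmult_assoc, Rinv_l, Rmult_1_r by nra.
  nra.
Qed.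

Lemma cont0_comp (A F : C -> C) : cont0 A -> cont0 F -> F C0 = C0 -> cont0 (fun z => A (F z)).
Proof.
  intros HA HF H0 eps Heps; rewrite H0.
  exact (near0_comp _ F HF H0 (HA eps Heps)).
Qed.

Ltac solve_cont0 := repeat (assumption || apply cont0_const || apply cont0_id || apply cont0_add
  || apply cont0_sub || apply cont0_mul || apply cont0_opp).

Lemma cont0_unique (F G : C -> C) : cont0 F -> cont0 G ->
  near0 (fun z => z <> C0 -> F z = G z) -> F C0 = G C0.
Proof.
  intros HF HG He.
  destruct (C_eq_dec (F C0) (G C0)) as [|Hne]; [assumption|exfalso].
  assert (Hn : (F C0 - G C0)%cpl <> C0).
  { intros E; apply Hne; replace (F C0) with (G C0 + (F C0 - G C0))%cpl by ring.
    rewrite E; ring. }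
  destruct (near0_and _ _ (cont0_near_neq (fun z => F z - G z)%cpl (cont0_sub _ _ HF HG) Hn) He)
    as (d & Hd & H).
  assert (Hm : Cmod (RtoC (d / 2)) < d) by (rewrite Cmod_RtoC, Rabs_right; lra).
  destruct (H _ Hm) as [H1 H2]; apply H1; rewrite H2; [ring|].
  apply RtoC_neq_C0; lra.
Qed.

(** * Complex derivatives *)

(** The difference quotient, completed by [d] at the origin, is continuous there. In this factored
    form the rules of calculus become ring identities between the functions [k]. *)
Lemma Cderiv_factor (f : C -> C) (z d : C) :
  Cderiv f z d <-> exists k, cont0 k /\ k C0 = d /\ forall u, f (z + u)%cpl = (f z + k u * u)%cpl.
Proof.
  split.
  - intros H.
    set (k := fun u => if C_eq_dec u C0 then d else ((f (z + u) - f z) / u)%cpl).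
    assert (k0 : k C0 = d) by (unfold k; destruct C_eq_dec; congruence).
    exists k; split; [|split; [exact k0|]].
    + intros eps Heps; destruct (H eps Heps) as (del & Hdel & Hu).
      exists del; split; [exact Hdel|]; intros u Hlt; rewrite k0; unfold k.
      destruct C_eq_dec as [->|Hne].
      * replace (d - d)%cpl with C0 by ring; rewrite Cmod_C0; exact Heps.
      * apply Hu; assumption.
    + intros u; unfold k; destruct C_eq_dec as [->|Hne].
      * replace (z + C0)%cpl with z by ring; ring.
      * field; exact Hne.
  - intros (k & Hk & <- & Hf) eps Heps; destruct (Hk eps Heps) as (del & Hdel & Hu).
    exists del; split; [exact Hdel|]; intros u Hne Hlt; rewrite Hf.
    replace ((f z + k u * u - f z) / u)%cpl with (k u) by (field; exact Hne).
    apply Hu; exact Hlt.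
Qed.

Lemma Cderiv_unique (f : C -> C) (z d e : C) : Cderiv f z d -> Cderiv f z e -> d = e.
Proof.
  intros Hd He; apply Cderiv_factor in Hd as (k & Hk & <- & Ek).
  apply Cderiv_factor in He as (l & Hl & <- & El).
  apply cont0_unique; trivial.
  exists 1; split; [lra|]; intros u _ Hu.
  replace (k u) with ((f (z + u) - f z) / u)%cpl by (rewrite Ek; field; exact Hu).
  rewrite El; field; exact Hu.
Qed.

Lemma Cderiv_cont0 (f : C -> C) (z d : C) : Cderiv f z d -> cont0 (fun u => f (z + u)%cpl).
Proof.
  intros H; apply Cderiv_factor in H as (k & Hk & _ & Ek).
  eapply cont0_ext; [|exact (cont0_add _ _ (cont0_const (f z)) (cont0_mul _ _ Hk cont0_id))].
  exists 1; split; [lra|]; intros u _; rewrite Ek; reflexivity.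
Qed.

Lemma Cderiv_at0_cont0 (f : C -> C) (d : C) : Cderiv f C0 d -> cont0 f.
Proof.
  intros H; apply Cderiv_cont0 in H; revert H; apply cont0_ext.
  exists 1; split; [lra|]; intros u _; f_equal; ring.
Qed.

Lemma Cderiv_ext (f g : C -> C) (z d : C) :
  near0 (fun u => f (z + u)%cpl = g (z + u)%cpl) -> Cderiv f z d -> Cderiv g z d.
Proof.
  intros (r & Hr & E) H eps Heps; destruct (H eps Heps) as (del & Hdel & Hu).
  assert (E0 : f z = g z).
  { specialize (E C0); rewrite Cmod_C0 in E; replace (z + C0)%cpl with z in E by ring.
    apply E; lra. }
  exists (Rmin r del); split; [apply Rmin_pos; assumption|]; intros u Hne Hlt.
  pose proof (Rmin_l r del); pose proof (Rmin_r r del).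
  rewrite <- E0, <- E by lra; apply Hu; [assumption|lra].
Qed.

Lemma Cderiv_const (c z : C) : Cderiv (fun _ => c) z C0.
Proof.
  apply Cderiv_factor; exists (fun _ => C0).
  repeat split; [apply cont0_const|intros; ring].
Qed.

Lemma Cderiv_id (z : C) : Cderiv (fun w => w) z C1.
Proof.
  apply Cderiv_factor; exists (fun _ => C1).
  repeat split; [apply cont0_const|intros; ring].
Qed.

Lemma Cderiv_add (f g : C -> C) (z d e : C) :
  Cderiv f z d -> Cderiv g z e -> Cderiv (fun w => f w + g w)%cpl z (d + e)%cpl.
Proof.
  intros Hd He; apply Cderiv_factor in Hd as (k & Hk & <- & Ek).
  apply Cderiv_factor in He as (l & Hl & <- & El).
  apply Cderiv_factor; exists (fun u => k u + l u)%cpl.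
  repeat split; [solve_cont0|intros; rewrite Ek, El; ring].
Qed.

Lemma Cderiv_mul (f g : C -> C) (z d e : C) :
  Cderiv f z d -> Cderiv g z e -> Cderiv (fun w => f w * g w)%cpl z (d * g z + f z * e)%cpl.
Proof.
  intros Hd He; apply Cderiv_factor in Hd as (k & Hk & <- & Ek).
  apply Cderiv_factor in He as (l & Hl & <- & El).
  apply Cderiv_factor; exists (fun u => k u * g z + f z * l u + k u * l u * u)%cpl.
  repeat split; [solve_cont0|ring|intros; rewrite Ek, El; ring].
Qed.

Lemma Cderiv_opp (f : C -> C) (z d : C) : Cderiv f z d -> Cderiv (fun w => - f w)%cpl z (- d)%cpl.
Proof.
  intros Hd; apply Cderiv_factor in Hd as (k & Hk & <- & Ek).
  apply Cderiv_factor; exists (fun u => - k u)%cpl.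
  repeat split; [solve_cont0|intros; rewrite Ek; ring].
Qed.

Lemma Cderiv_sub (f g : C -> C) (z d e : C) :
  Cderiv f z d -> Cderiv g z e -> Cderiv (fun w => f w - g w)%cpl z (d - e)%cpl.
Proof. intros Hd He; apply Cderiv_add; [|apply Cderiv_opp]; assumption. Qed.

Lemma Cderiv_comp (g f : C -> C) (z d e : C) :
  Cderiv f z d -> Cderiv g (f z) e -> Cderiv (fun w => g (f w)) z (e * d)%cpl.
Proof.
  intros Hd He; apply Cderiv_factor in Hd as (k & Hk & <- & Ek).
  apply Cderiv_factor in He as (l & Hl & <- & El).
  apply Cderiv_factor; exists (fun u => l (k u * u) * k u)%cpl.
  repeat split.
  - apply cont0_mul; [|exact Hk].
    apply (cont0_comp l (fun u => k u * u)%cpl); [exact Hl|solve_cont0|ring].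
  - do 2 f_equal; ring.
  - intros; rewrite Ek, El; ring.
Qed.

Lemma Cderiv_inv (z : C) : z <> C0 -> Cderiv Cinv z (- (/ z * / z))%cpl.
Proof.
  intros Hz eps Heps.
  assert (HF : cont0 (fun u => - (/ (z + u) * / z))%cpl).
  { apply cont0_opp, cont0_mul; [|apply cont0_const].
    apply cont0_inv; [solve_cont0|]; replace (z + C0)%cpl with z by ring; exact Hz. }
  assert (HN : near0 (fun u => (z + u)%cpl <> C0)).
  { apply cont0_near_neq; [solve_cont0|]; replace (z + C0)%cpl with z by ring; exact Hz. }
  destruct (near0_and _ _ HN (HF eps Heps)) as (d & Hd & H).
  exists d; split; [exact Hd|]; intros u Hu Hlt; destruct (H u Hlt) as [H1 H2].
  replace (z + C0)%cpl with z in H2 by ring.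
  replace ((/ (z + u) - / z) / u)%cpl with (- (/ (z + u) * / z))%cpl by (field; auto).
  exact H2.
Qed.

(** * Second-order expansions at the origin *)

(** A Peano expansion in factored form. The identity is asked for every [z], but away from the
    origin it merely defines [k]; the content is the continuity of [k] at [0] with value [c2]. *)
Definition taylor2 (F : C -> C) (c0 c1 c2 : C) : Prop :=
  exists k, cont0 k /\ k C0 = c2 /\ forall z, F z = (c0 + c1 * z + k z * (z * z))%cpl.

Lemma taylor2_ext (F G : C -> C) (c0 c1 c2 : C) :
  near0 (fun z => F z = G z) -> taylor2 F c0 c1 c2 -> taylor2 G c0 c1 c2.
Proof.
  intros He (k & Hk & k0 & Ek).
  set (l := fun z => if C_eq_dec z C0 then c2 else ((G z - c0 - c1 * z) / (z * z))%cpl).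
  exists l; split; [|split].
  - revert Hk; apply cont0_ext; generalize He; apply near0_imp; intros z E.
    unfold l; destruct C_eq_dec as [->|Hne]; [exact k0|].
    rewrite <- E, Ek; field; exact Hne.
  - unfold l; destruct C_eq_dec; congruence.
  - intros z; unfold l; destruct C_eq_dec as [->|Hne].
    + rewrite <- (near0_at _ He), Ek; ring.
    + field; exact Hne.
Qed.

Lemma taylor2_cont0 (F : C -> C) (c0 c1 c2 : C) : taylor2 F c0 c1 c2 -> cont0 F.
Proof.
  intros (k & Hk & k0 & Ek).
  apply (cont0_ext (fun z => c0 + c1 * z + k z * (z * z))%cpl); [|solve_cont0].
  exists 1; split; [lra|]; intros z _; rewrite Ek; reflexivity.
Qed.

Lemma taylor2_at0 (F : C -> C) (c0 c1 c2 : C) : taylor2 F c0 c1 c2 -> F C0 = c0.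
Proof. intros (k & Hk & k0 & Ek); rewrite Ek; ring. Qed.

Lemma taylor2_const (c : C) : taylor2 (fun _ => c) c C0 C0.
Proof. exists (fun _ => C0); repeat split; [solve_cont0|intros; ring]. Qed.

Lemma taylor2_id : taylor2 (fun z => z) C0 C1 C0.
Proof. exists (fun _ => C0); repeat split; [solve_cont0|intros; ring]. Qed.

Lemma taylor2_add (F G : C -> C) (c0 c1 c2 e0 e1 e2 : C) :
  taylor2 F c0 c1 c2 -> taylor2 G e0 e1 e2 ->
  taylor2 (fun z => F z + G z)%cpl (c0 + e0)%cpl (c1 + e1)%cpl (c2 + e2)%cpl.
Proof.
  intros (k & Hk & <- & Ek) (l & Hl & <- & El); exists (fun z => k z + l z)%cpl.
  repeat split; [solve_cont0|intros; rewrite Ek, El; ring].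
Qed.

Lemma taylor2_mul (F G : C -> C) (c0 c1 c2 e0 e1 e2 : C) :
  taylor2 F c0 c1 c2 -> taylor2 G e0 e1 e2 ->
  taylor2 (fun z => F z * G z)%cpl
    (c0 * e0)%cpl (c0 * e1 + c1 * e0)%cpl (c0 * e2 + c1 * e1 + c2 * e0)%cpl.
Proof.
  intros (k & Hk & <- & Ek) (l & Hl & <- & El).
  exists (fun z => c0 * l z + c1 * e1 + k z * e0 + (c1 * l z + k z * e1) * z
                   + k z * l z * (z * z))%cpl.
  repeat split; [solve_cont0|ring|intros; rewrite Ek, El; ring].
Qed.

Lemma taylor2_comp (A F : C -> C) (b0 b1 b2 c1 c2 : C) :
  taylor2 A b0 b1 b2 -> taylor2 F C0 c1 c2 ->
  taylor2 (fun z => A (F z)) b0 (b1 * c1)%cpl (b1 * c2 + b2 * (c1 * c1))%cpl.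
Proof.
  intros (al & Hal & <- & Eal) HF.
  pose proof (taylor2_cont0 _ _ _ _ HF) as CF; pose proof (taylor2_at0 _ _ _ _ HF) as F0.
  destruct HF as (k & Hk & <- & Ek).
  exists (fun z => b1 * k z + al (F z) * ((c1 + k z * z) * (c1 + k z * z)))%cpl.
  split; [|split].
  - pose proof (cont0_comp al F Hal CF F0); solve_cont0.
  - rewrite F0; ring.
  - intros z; rewrite Eal, Ek; ring.
Qed.

(** Cancels an outer function, knowing only that [F] is continuous at the origin. From
    [A (F z) - b0 = F z * be z], where [be] tends to [b1 <> 0], division gives [F z = z * m z] with
    [m] continuous at [0]. Putting this back into the quadratic term of [A] yields the order-two
    expansion. It recovers [w] from [phi o w], [h] from [exp o h], and [g] from [f o g = id]. *)
Lemma taylor2_uncomp (A F : C -> C) (b0 b1 b2 d1 d2 : C) :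
  b1 <> C0 -> taylor2 A b0 b1 b2 -> cont0 F -> F C0 = C0 ->
  taylor2 (fun z => A (F z)) b0 d1 d2 ->
  taylor2 F C0 (d1 / b1)%cpl ((d2 - b2 * ((d1 / b1) * (d1 / b1))) / b1)%cpl.
Proof.
  intros Hb (al & Hal & <- & Eal) CF F0 (ka & Hka & <- & Eka).
  pose proof (cont0_comp al F Hal CF F0) as CaF.
  set (be := fun z => (b1 + al (F z) * F z)%cpl).
  assert (Cbe : cont0 be) by (unfold be; solve_cont0).
  assert (be0 : be C0 = b1) by (unfold be; rewrite F0; ring).
  assert (Nbe : near0 (fun z => be z <> C0)) by (apply cont0_near_neq; [exact Cbe|rewrite be0; exact Hb]).
  set (m := fun z => ((d1 + ka z * z) * / be z)%cpl).
  assert (Cm : cont0 m).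
  { unfold m; apply cont0_mul; [solve_cont0|apply cont0_inv; [exact Cbe|rewrite be0; exact Hb]]. }
  apply (taylor2_ext (fun z => C0 + d1 / b1 * z +
     ((ka z - al (F z) * (m z * m z)) * / b1) * (z * z))%cpl).
  - generalize Nbe; apply near0_imp; intros z Hz.
    assert (E : (F z * be z)%cpl = (z * (d1 + ka z * z))%cpl).
    { unfold be; specialize (Eal (F z)); rewrite Eka in Eal.
      replace (F z * (b1 + al (F z) * F z))%cpl
        with ((b0 + b1 * F z + al (F z) * (F z * F z)) - b0)%cpl by ring.
      rewrite <- Eal; ring. }
    assert (Em : F z = (z * m z)%cpl).
    { replace (F z) with (F z * be z * / be z)%cpl by (field; exact Hz).
      rewrite E; unfold m; ring. }
    replace (C0 + d1 / b1 * z + (ka z - al (F z) * (m z * m z)) * / b1 * (z * z))%cpl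
      with ((z * (d1 + ka z * z) - al (F z) * ((z * m z) * (z * m z))) * / b1)%cpl
      by (field; exact Hb).
    rewrite <- Em, <- E; unfold be; field; exact Hb.
  - exists (fun z => (ka z - al (F z) * (m z * m z)) * / b1)%cpl; split; [solve_cont0|].
    split; [|reflexivity].
    unfold m; rewrite be0, F0; field; exact Hb.
Qed.

(** After division by [z^2] the error is at most [K |z|], which tends to [0]; at [z = 0] the bound
    forces [F C0 = c0]. *)
Lemma taylor2_of_cubic (F : C -> C) (c0 c1 c2 : C) (K : R) :
  near0 (fun z => Cmod (F z - (c0 + c1 * z + c2 * (z * z)))%cpl <= K * Cmod z ^ 3) ->
  taylor2 F c0 c1 c2.
Proof.
  intros HF.
  set (k := fun z => if C_eq_dec z C0 then c2 else ((F z - c0 - c1 * z) / (z * z))%cpl).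
  assert (k0 : k C0 = c2) by (unfold k; destruct C_eq_dec; congruence).
  exists k; split; [|split; [exact k0|]].
  - intros eps Heps.
    assert (HK : 0 < Rabs K + 1) by (pose proof (Rabs_pos K); lra).
    assert (Hs : near0 (fun z => Cmod z < eps / (Rabs K + 1))).
    { exists (eps / (Rabs K + 1)); split; [apply Rdiv_lt_0_compat; lra|trivial]. }
    generalize (near0_and _ _ HF Hs); apply near0_imp; intros z [Hz1 Hz2].
    rewrite k0; unfold k; destruct C_eq_dec as [->|Hne].
    + replace (c2 - c2)%cpl with C0 by ring; rewrite Cmod_C0; exact Heps.
    + replace ((F z - c0 - c1 * z) / (z * z) - c2)%cpl
        with ((F z - (c0 + c1 * z + c2 * (z * z))) * / (z * z))%cpl by (field; exact Hne).
      pose proof (Cmod_pos _ Hne) as Hp.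
      rewrite Cmod_mul, Cmod_cinv, Cmod_mul.
      2: { intros E; apply Hne, (Cmul_integral _ _ E Hne). }
      apply (Rmult_lt_reg_r (Cmod z * Cmod z)); [nra|].
      rewrite Rmult_assoc, Rinv_l, Rmult_1_r by nra.
      eapply Rle_lt_trans; [exact Hz1|].
      pose proof (Rle_abs K).
      assert (Cmod z * (Rabs K + 1) < eps).
      { apply (Rmult_lt_compat_r (Rabs K + 1)) in Hz2; [|lra].
        replace (eps / (Rabs K + 1) * (Rabs K + 1)) with eps in Hz2 by (field; lra); exact Hz2. }
      assert (K * Cmod z < eps) by nra.
      assert (0 < Cmod z * Cmod z) by nra.
      nra.
  - intros z; unfold k; destruct C_eq_dec as [->|Hne]; [|field; exact Hne].
    generalize (near0_at _ HF); rewrite Cmod_C0; intros H.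
    assert (E : (F C0 - c0)%cpl = C0).
    { apply Cmod_zero; replace (F C0 - c0)%cpl with (F C0 - (c0 + c1 * C0 + c2 * (C0 * C0)))%cpl by ring.
      apply Rle_antisym; [|apply Cmod_nonneg]; eapply Rle_trans; [exact H|right; ring]. }
    replace (F C0) with (c0 + (F C0 - c0))%cpl by ring; rewrite E; ring.
Qed.

(** * The exponential and circle means *)

Lemma Rabs_fst_le (z : C) : Rabs (fst z) <= Cmod z.
Proof. exact (Rle_trans _ _ _ (Rmax_l _ _) (Rmax_Cmod z)). Qed.

Lemma Rabs_snd_le (z : C) : Rabs (snd z) <= Cmod z.
Proof. exact (Rle_trans _ _ _ (Rmax_r _ _) (Rmax_Cmod z)). Qed.

Lemma Cmod_le_2Rmax (z : C) : Cmod z <= 2 * Rmax (Rabs (fst z)) (Rabs (snd z)).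
Proof.
  eapply Rle_trans; [exact (Cmod_2Rmax z)|].
  apply Rmult_le_compat_r.
  - eapply Rle_trans; [apply Rabs_pos|apply Rmax_l].
  - apply Rsqr_incr_0; unfold Rsqr; [rewrite sqrt_sqrt; lra|apply sqrt_pos|lra].
Qed.

(** Mean value theorem between [0] and [x]. The factor [1 / (n + 1)] of exact integration is given
    up, so the constant [M] is unchanged when the lemma is iterated. *)
Lemma Rabs_antideriv_le (F F' : R -> R) (M : R) (n : nat) :
  F 0 = 0 ->
  (forall x, Rabs x <= 1 -> is_derive F x (F' x) /\ Rabs (F' x) <= M * Rabs x ^ n) ->
  forall x, Rabs x <= 1 -> Rabs (F x) <= M * Rabs x ^ S n.
Proof.
  intros F0 HF x Hx.
  assert (Hin : forall y, Rmin 0 x <= y <= Rmax 0 x -> Rabs y <= Rabs x).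
  { intros y; unfold Rmin, Rmax, Rabs; destruct Rle_dec;
      repeat destruct Rcase_abs; lra. }
  destruct (MVT_gen F 0 x F') as (c & Hc & E).
  - intros y Hy; apply HF; specialize (Hin y ltac:(lra)); lra.
  - intros y Hy; apply continuity_pt_filterlim.
    apply (ex_derive_continuous F); exists (F' y).
    apply HF; specialize (Hin y Hy); lra.
  - rewrite F0, !Rminus_0_r in E; rewrite E, Rabs_mult.
    specialize (Hin c Hc).
    destruct (HF c ltac:(lra)) as [_ Hb].
    assert (HM : 0 <= M).
    { destruct (HF 1 ltac:(rewrite Rabs_R1; lra)) as [_ H1].
      rewrite Rabs_R1, pow1 in H1; pose proof (Rabs_pos (F' 1)); lra. }
    replace (M * Rabs x ^ S n) with (M * Rabs x ^ n * Rabs x) by (simpl; ring).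
    apply Rmult_le_compat_r; [apply Rabs_pos|].
    eapply Rle_trans; [exact Hb|].
    apply Rmult_le_compat_l; [exact HM|].
    apply pow_incr; split; [apply Rabs_pos|exact Hin].
Qed.

(** Three successive integrations starting from [exp <= 3] on [[-1, 1]], which is the origin of the
    constant. *)
Lemma exp_taylor (x : R) : Rabs x <= 1 -> Rabs (exp x - 1 - x - x ^ 2 / 2) <= 3 * Rabs x ^ 3.
Proof.
  revert x; apply (Rabs_antideriv_le _ (fun x => exp x - 1 - x)).
  { rewrite exp_0; field. }
  intros x Hx; split; [auto_derive; [trivial|field]|].
  revert x Hx; apply (Rabs_antideriv_le _ (fun x => exp x - 1)).
  { rewrite exp_0; ring. }
  intros x Hx; split; [auto_derive; [trivial|ring]|].
  revert x Hx; apply (Rabs_antideriv_le _ (fun x => exp x)).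
  { rewrite exp_0; ring. }
  intros x Hx; split; [auto_derive; [trivial|ring]|].
  simpl; rewrite Rmult_1_r, Rabs_right by (left; apply exp_pos).
  apply Rabs_le_between in Hx.
  eapply Rle_trans; [|apply exp_le_3].
  destruct (Req_dec x 1) as [->|]; [lra|left; apply exp_increasing; lra].
Qed.

Lemma sin_taylor (x : R) : Rabs x <= 1 -> Rabs (sin x - x) <= Rabs x ^ 3.
Proof.
  intros Hx; rewrite <- (Rmult_1_l (_ ^ 3)); revert x Hx.
  apply (Rabs_antideriv_le _ (fun x => cos x - 1)).
  { rewrite sin_0; ring. }
  intros x Hx; split; [auto_derive; [trivial|ring]|].
  revert x Hx; apply (Rabs_antideriv_le _ (fun x => - sin x)).
  { rewrite cos_0; ring. }
  intros x Hx; split; [auto_derive; [trivial|ring]|].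
  rewrite Rabs_Ropp.
  revert x Hx; apply (Rabs_antideriv_le _ (fun x => cos x)).
  { apply sin_0. }
  intros x Hx; split; [auto_derive; [trivial|ring]|].
  simpl; rewrite Rmult_1_r; apply Rabs_le, COS_bound.
Qed.

Lemma cos_taylor (x : R) : Rabs x <= 1 -> Rabs (cos x - 1 + x ^ 2 / 2) <= Rabs x ^ 3.
Proof.
  intros Hx; apply Rle_trans with (1 * Rabs x ^ 4).
  - revert x Hx; apply (Rabs_antideriv_le _ (fun x => - sin x + x)).
    { rewrite cos_0; field. }
    intros x Hx; split; [auto_derive; [trivial|field]|].
    replace (- sin x + x) with (- (sin x - x)) by ring; rewrite Rabs_Ropp, Rmult_1_l.
    apply sin_taylor, Hx.
  - pose proof (Rabs_pos x); pose proof (pow_le (Rabs x) 3 H).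
    replace (1 * Rabs x ^ 4) with (Rabs x * Rabs x ^ 3) by ring; nra.
Qed.

Lemma Cexp_add (z w : C) : Cexp (z + w)%cpl = (Cexp z * Cexp w)%cpl.
Proof.
  unfold Cexp, Cadd, Cmul; simpl; rewrite exp_plus, cos_plus, sin_plus.
  f_equal; ring.
Qed.

Lemma Cexp_0 : Cexp C0 = C1.
Proof. unfold Cexp, C0, C1; simpl; rewrite exp_0, cos_0, sin_0; f_equal; ring. Qed.

Lemma Cexp_taylor2 : taylor2 Cexp C1 C1 (RtoC (1 / 2)).
Proof.
  (* The constant is generous: the errors of the real and imaginary parts found below are each under
     [13 r^3], and the modulus is at most twice the larger of them. *)
  apply (taylor2_of_cubic _ _ _ _ 100); exists 1; split; [lra|]; intros [x y] Hz.
  set (r := Cmod (x, y)) in *.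
  assert (Hx : Rabs x <= r) by exact (Rabs_fst_le (x, y)).
  assert (Hy : Rabs y <= r) by exact (Rabs_snd_le (x, y)).
  assert (Hr : 0 <= r) by apply Cmod_nonneg.
  pose proof (exp_taylor x ltac:(lra)) as Ha.
  pose proof (cos_taylor y ltac:(lra)) as Hb.
  pose proof (sin_taylor y ltac:(lra)) as Hc.
  set (a := exp x - 1 - x - x ^ 2 / 2) in *.
  set (b := cos y - 1 + y ^ 2 / 2) in *.
  set (c := sin y - y) in *.
  assert (E1 : exp x = 1 + x + x ^ 2 / 2 + a) by (unfold a; ring).
  assert (E2 : cos y = 1 - y ^ 2 / 2 + b) by (unfold b; ring).
  assert (E3 : sin y = y + c) by (unfold c; ring).
  clearbody a b c.
  assert (B3 : forall t, Rabs t <= r -> Rabs t ^ 3 <= r ^ 3).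
  { intros t Ht; apply pow_incr; split; [apply Rabs_pos|exact Ht]. }
  assert (Ha' : Rabs a <= 3 * r ^ 3) by (specialize (B3 x Hx); lra).
  assert (Hb' : Rabs b <= r ^ 3) by (specialize (B3 y Hy); lra).
  assert (Hc' : Rabs c <= r ^ 3) by (specialize (B3 y Hy); lra).
  assert (M : forall s t S T, Rabs s <= S -> Rabs t <= T -> Rabs (s * t) <= S * T).
  { intros; rewrite Rabs_mult; apply Rmult_le_compat; auto using Rabs_pos. }
  assert (P3 : 0 <= r ^ 3) by (apply pow_le; exact Hr).
  assert (r ^ 3 <= 1) by (rewrite <- (pow1 3); apply pow_incr; lra).
  assert (r * r <= 1) by nra.
  assert (Hxx : Rabs (x * x) <= 1).
  { eapply Rle_trans; [apply (M _ _ r r); assumption|nra]. }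
  assert (Hyy : Rabs (y * y) <= 1).
  { eapply Rle_trans; [apply (M _ _ r r); assumption|nra]. }
  assert (Hxyy : Rabs (x * (y * y)) <= r ^ 3).
  { eapply Rle_trans; [apply (M _ _ r (r * r)); [|apply M]; assumption|right; ring]. }
  assert (Hxxy : Rabs (x * x * y) <= r ^ 3).
  { eapply Rle_trans; [apply (M _ _ (r * r) r); [apply M|]; assumption|right; ring]. }
  assert (Hxxyy : Rabs (x * (x * (y * y))) <= r ^ 3).
  { eapply Rle_trans; [apply (M _ _ 1 (r ^ 3)); [lra|exact Hxyy]|right; ring]. }
  assert (Hu : Rabs (1 - y * y / 2 + b) <= 3).
  { apply Rabs_le_between in Hyy; apply Rabs_le_between in Hb'; apply Rabs_le; lra. }
  assert (Hv : Rabs (1 + x + x * x / 2) <= 3).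
  { apply Rabs_le_between in Hxx; assert (Hx1 : Rabs x <= 1) by lra;
    apply Rabs_le_between in Hx1; apply Rabs_le; lra. }
  assert (Hw : Rabs (y + c) <= 2).
  { apply Rabs_le_between in Hc'; assert (Hy1 : Rabs y <= 1) by lra;
    apply Rabs_le_between in Hy1; apply Rabs_le; lra. }
  pose proof (M _ _ _ _ Ha' Hu) as T1.
  pose proof (M _ _ _ _ Hb' Hv) as T2.
  pose proof (M _ _ _ _ Ha' Hw) as T3.
  pose proof (M _ _ _ _ Hc' Hv) as T4.
  eapply Rle_trans; [apply Cmod_le_2Rmax|].
  assert (G : forall s t, Rmax s t <= 50 * r ^ 3 -> 2 * Rmax s t <= 100 * r ^ 3)
    by (intros; lra).
  apply G, Rmax_lub; unfold Cexp, Csub, Copp, Cadd, Cmul, RtoC, C1; cbn [fst snd];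
    rewrite E1, ?E2, ?E3.
  - match goal with |- Rabs ?e <= _ => replace e with
      (- (x * (y * y)) / 2 - x * (x * (y * y)) / 4 + a * (1 - y * y / 2 + b)
         + b * (1 + x + x * x / 2)) by field end.
    apply Rabs_le_between in Hxyy; apply Rabs_le_between in Hxxyy.
    apply Rabs_le_between in T1; apply Rabs_le_between in T2.
    apply Rabs_le; lra.
  - match goal with |- Rabs ?e <= _ => replace e with
      ((x * x * y) / 2 + a * (y + c) + c * (1 + x + x * x / 2)) by field end.
    apply Rabs_le_between in Hxxy.
    apply Rabs_le_between in T3; apply Rabs_le_between in T4.
    apply Rabs_le; lra.
Qed.

(** The addition formula transports the expansion at the origin to the point [z]. *)
Lemma Cderiv_Cexp (z : C) : Cderiv Cexp z (Cexp z).
Proof.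
  destruct Cexp_taylor2 as (k & Hk & k0 & Ek).
  apply Cderiv_factor; exists (fun u => Cexp z * (C1 + k u * u))%cpl.
  repeat split; [solve_cont0|ring|].
  intros u; rewrite Cexp_add, (Ek u); ring.
Qed.

(** * Cauchy-Riemann relations and means over circles *)

(** Multiplication by [d] is the real linear map with rows [(Re d, - Im d)] and [(Im d, Re d)];
    these are the Cauchy-Riemann relations as a total differential. The equality of the entries
    [Re d] makes [Im f dx + Re f dy], the imaginary part of [f dz], a closed form. *)
Lemma Cderiv_differentiable (f : C -> C) (x y : R) (d : C) :
  Cderiv f (x, y) d ->
  differentiable_pt_lim (fun u v => fst (f (u, v))) x y (fst d) (- snd d) /\
  differentiable_pt_lim (fun u v => snd (f (u, v))) x y (snd d) (fst d).
Proof.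
  intros H; apply Cderiv_factor in H as (k & Hk & k0 & Ek).
  assert (key : forall eps : posreal, exists del : posreal, forall u v,
    Rabs (u - x) < del -> Rabs (v - y) < del ->
    Cmod (f (u, v) - f (x, y) - d * (u - x, v - y)%R)%cpl
      <= eps * Rmax (Rabs (u - x)) (Rabs (v - y))).
  { intros eps; pose proof (cond_pos eps) as Heps.
    destruct (Hk (eps / 2) ltac:(lra)) as (del & Hdel & Hu).
    assert (Hd2 : 0 < del / 2) by lra.
    exists (mkposreal _ Hd2); simpl; intros u v Hux Hvy.
    pose proof (Cmod_le_2Rmax (u - x, v - y)%R) as Hm; cbn [fst snd] in Hm.
    pose proof (Rmax_lub_lt _ _ _ Hux Hvy).
    specialize (Hu (u - x, v - y)%R ltac:(lra)).
    replace (u, v) with ((x, y) + (u - x, v - y)%R)%cpl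
      by (unfold Cadd; simpl; f_equal; ring).
    rewrite Ek.
    match goal with |- Cmod ?e <= _ => replace e with
      ((k (u - x, v - y)%R - d) * (u - x, v - y)%R)%cpl by ring end.
    rewrite Cmod_mul; rewrite k0 in Hu.
    eapply Rle_trans; [apply Rmult_le_compat; [apply Cmod_nonneg|apply Cmod_nonneg|left; exact Hu|exact Hm]|].
    right; field. }
  split; intros eps; destruct (key eps) as [del Hdel]; exists del; intros u v Hux Hvy;
    (eapply Rle_trans; [|apply (Hdel u v Hux Hvy)]).
  - eapply Rle_trans; [|apply Rabs_fst_le]; right; f_equal.
    unfold Csub, Cadd, Copp, Cmul; simpl; ring.
  - eapply Rle_trans; [|apply Rabs_snd_le]; right; f_equal.
    unfold Csub, Cadd, Copp, Cmul; simpl; ring.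
Qed.

Definition circ (r t : R) : C := (r * cos t, r * sin t).

Lemma circ_Cexp (r t : R) : 0 < r -> circ r t = Cexp (ln r, t).
Proof. intros Hr; unfold circ, Cexp; simpl; rewrite exp_ln by exact Hr; reflexivity. Qed.

Lemma Cmod_circ (r t : R) : 0 <= r -> Cmod (circ r t) = r.
Proof.
  intros Hr; unfold Cmod, circ; simpl.
  replace (_ + _) with (r * r * (Rsqr (sin t) + Rsqr (cos t))) by (unfold Rsqr; ring).
  rewrite sin2_cos2, Rmult_1_r; apply sqrt_square, Hr.
Qed.

Lemma Cmod_Cexp (z : C) : Cmod (Cexp z) = exp (fst z).
Proof. apply Cmod_circ; left; apply exp_pos. Qed.

Definition analytic_punctured (W : C -> C) : Prop :=
  forall z, inU z -> z <> C0 -> exists d, Cderiv W z d.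

(* Cauchy's theorem on the rectangle [[ln r1, ln r2] x [0, 2 pi]] for [W o exp]:
   the horizontal sides cancel by periodicity. *)
Lemma circle_mean (W : C -> C) (r1 r2 : R) :
  analytic_punctured W -> 0 < r1 -> r1 <= r2 -> r2 < 1 ->
  RInt (fun t => fst (W (circ r1 t))) 0 (2 * PI) = RInt (fun t => fst (W (circ r2 t))) 0 (2 * PI).
Proof.
  intros HW H1 H12 H2.
  assert (Hln : 0 <= ln r2 - ln r1).
  { destruct H12 as [H12| ->]; [|lra]; pose proof (ln_increasing r1 r2 H1 H12); lra. }
  assert (Hln2 : ln r2 < 0) by (rewrite <- ln_1; apply ln_increasing; lra).
  pose proof PI_RGT_0 as HPI.
  set (A := fun s t => fst (W (Cexp (s, t)))).
  set (B := fun s t => snd (W (Cexp (s, t)))).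
  (* [B ds + A dt] is the imaginary part of [W (exp z) dz]. Its vertical sides are the integrals of
     [Re W] over the two circles. *)
  assert (Hcl : closed_on B A (ln r1) 0 (ln r2 - ln r1) (2 * PI)).
  { intros s t Hs Ht.
    destruct (HW (Cexp (s, t))) as [d Hd].
    - unfold inU; rewrite Cmod_Cexp; simpl; rewrite <- exp_0; apply exp_increasing; lra.
    - intros E; apply (f_equal Cmod) in E; rewrite Cmod_Cexp, Cmod_C0 in E.
      simpl in E; pose proof (exp_pos s); lra.
    - destruct (Cderiv_differentiable (fun z => W (Cexp z)) s t _
        (Cderiv_comp W Cexp (s, t) _ _ (Cderiv_Cexp (s, t)) Hd)) as [DA DB].
      do 3 eexists; split; [exact DB|exact DA]. }
  assert (H2PI : 0 <= 2 * PI) by lra.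
  pose proof (goursat_rect _ _ _ _ _ _ Hln H2PI Hcl) as HG.
  rewrite rect_int_split in HG; trivial; try lra.
  replace (ln r1 + (ln r2 - ln r1)) with (ln r2) in HG by ring.
  rewrite !Rplus_0_l in HG.
  assert (EB : RInt (fun s => B s (2 * PI)) (ln r1) (ln r2) = RInt (fun s => B s 0) (ln r1) (ln r2)).
  { apply RInt_ext; intros s _; unfold B, Cexp; simpl.
    rewrite cos_2PI, sin_2PI, cos_0, sin_0; reflexivity. }
  rewrite EB in HG.
  transitivity (RInt (fun t => A (ln r1) t) 0 (2 * PI)).
  - apply RInt_ext; intros t _; unfold A; rewrite circ_Cexp by lra; reflexivity.
  - transitivity (RInt (fun t => A (ln r2) t) 0 (2 * PI)); [lra|].
    apply RInt_ext; intros t _; unfold A; rewrite circ_Cexp by lra; reflexivity.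
Qed.

Lemma ex_RInt_circle (W : C -> C) (r : R) :
  analytic_punctured W -> 0 < r < 1 ->
  ex_RInt (fun t => fst (W (circ r t))) 0 (2 * PI).
Proof.
  intros HW Hr; apply (ex_RInt_continuous (V := R_CompleteNormedModule)); intros t _.
  destruct (HW (circ r t)) as [d Hd].
  - unfold inU; rewrite Cmod_circ; lra.
  - intros E; apply (f_equal Cmod) in E; rewrite Cmod_circ, Cmod_C0 in E; lra.
  - rewrite circ_Cexp in Hd by lra.
    destruct (Cderiv_differentiable (fun z => W (Cexp z)) (ln r) t _
        (Cderiv_comp W Cexp (ln r, t) _ _ (Cderiv_Cexp (ln r, t)) Hd)) as [DA _].
    generalize (differentiable_continuous_r _ _ _ _ _ DA).
    apply continuous_ext; intros u; rewrite circ_Cexp by lra; reflexivity.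
Qed.

(** * Caratheodory's inequality *)

Definition cdiff (f : C -> C) (z : C) : Prop := exists d, Cderiv f z d.

Lemma cdiff_const (c z : C) : cdiff (fun _ => c) z.
Proof. eexists; apply Cderiv_const. Qed.

Lemma cdiff_id (z : C) : cdiff (fun w => w) z.
Proof. eexists; apply Cderiv_id. Qed.

Lemma cdiff_add (f g : C -> C) (z : C) : cdiff f z -> cdiff g z -> cdiff (fun w => f w + g w)%cpl z.
Proof. intros [d Hd] [e He]; eexists; apply Cderiv_add; eassumption. Qed.

Lemma cdiff_sub (f g : C -> C) (z : C) : cdiff f z -> cdiff g z -> cdiff (fun w => f w - g w)%cpl z.
Proof. intros [d Hd] [e He]; eexists; apply Cderiv_sub; eassumption. Qed.

Lemma cdiff_mul (f g : C -> C) (z : C) : cdiff f z -> cdiff g z -> cdiff (fun w => f w * g w)%cpl z.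
Proof. intros [d Hd] [e He]; eexists; apply Cderiv_mul; eassumption. Qed.

Lemma cdiff_inv (f : C -> C) (z : C) : cdiff f z -> f z <> C0 -> cdiff (fun w => / f w)%cpl z.
Proof.
  intros [d Hd] H0; eexists.
  exact (Cderiv_comp Cinv f z _ _ Hd (Cderiv_inv _ H0)).
Qed.

Lemma circ_neq_C0 (r t : R) : 0 < r -> circ r t <> C0.
Proof. intros Hr E; apply (f_equal Cmod) in E; rewrite Cmod_circ, Cmod_C0 in E; lra. Qed.

Lemma circ_inv (r t : R) : 0 < r -> (/ circ r t)%cpl = circ (/ r) (- t).
Proof.
  intros Hr; unfold Cinv, circ; cbn [fst snd]; rewrite cos_neg, sin_neg.
  assert (E : (r * cos t) ^ 2 + (r * sin t) ^ 2 = r * r).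
  { transitivity (r * r * (Rsqr (sin t) + Rsqr (cos t))); [unfold Rsqr; ring|].
    rewrite sin2_cos2; ring. }
  rewrite E; f_equal; field; lra.
Qed.

(** The real part of a combination of [1 / z^2] and [1 / z] on the circle is a trigonometric
    polynomial without constant term; [F] is an explicit antiderivative of period [2 PI]. *)
Lemma is_RInt_circle_pole (al be : C) (r : R) : 0 < r ->
  is_RInt (fun t => fst (al * (/ circ r t * / circ r t) + be * / circ r t)%cpl) 0 (2 * PI) 0.
Proof.
  intros Hr.
  set (F := fun t => (fst al * (sin t * cos t) + snd al * (sin t * sin t)) * (/ r * / r)
                     + (fst be * sin t - snd be * cos t) * / r).
  replace 0 with (minus (F (2 * PI)) (F 0)) at 2.
  2: { unfold F, minus, plus, opp; simpl; rewrite sin_2PI, cos_2PI, sin_0, cos_0; ring. }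
  apply (is_RInt_ext (fun t => (fst al * (cos t * cos t - sin t * sin t)
     + snd al * (2 * sin t * cos t)) * (/ r * / r)
     + (fst be * cos t + snd be * sin t) * / r)).
  { intros t _; rewrite circ_inv by exact Hr; unfold circ, Cmul, Cadd; cbn [fst snd].
    rewrite cos_neg, sin_neg; match goal with |- ?a = ?b => change (@eq R a b) end; ring. }
  apply (is_RInt_derive (V := R_CompleteNormedModule) F).
  - intros t _; unfold F; auto_derive; [trivial|ring].
  - intros t _; apply (ex_derive_continuous (V := R_NormedModule)); auto_derive; trivial.
Qed.

(* On [|z| = r] the second factor of [W] is [2 - 2 Re (c r^2 / z^2) >= 0], so
   the mean of [Re W] is nonnegative; as the radius tends to [0] the polar part
   of [W] averages to [0] and what remains tends to [2 - r^2 c p2]. *)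
Lemma caratheodory_aux (p : C -> C) (p1 p2 c : C) (r : R) :
  analytic_on_U p -> (forall z, inU z -> 0 <= fst (p z)) -> taylor2 p C1 p1 p2 ->
  Cmod c = 1 -> 0 < r < 1 -> r ^ 2 * fst (c * p2)%cpl <= 2.
Proof.
  intros Hp Hre Ht Hc Hr.
  pose proof (taylor2_cont0 _ _ _ _ Ht) as Cp; pose proof (taylor2_at0 _ _ _ _ Ht) as p0.
  destruct Ht as (k & Hk & k0 & Ek).
  assert (Hr2 : 0 < r ^ 2) by nra.
  set (W := fun z => (p z * (RtoC 2 - RtoC (r ^ 2) * c * (/ z * / z)
                             - RtoC (/ r ^ 2) * Cconj c * (z * z)))%cpl).
  (* [p] is expanded only where it meets the pole: [al * p z / z^2 = S z + al * k z]. Everything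
     else is collected in [T], which is continuous at the origin, so that [W = T - S]. *)
  set (al := (RtoC (r ^ 2) * c)%cpl).
  set (S := fun z => (al * (/ z * / z) + al * p1 * / z)%cpl).
  set (T := fun z => (RtoC 2 * p z - RtoC (/ r ^ 2) * Cconj c * (p z * (z * z))
                      - al * k z)%cpl).
  assert (HWan : analytic_punctured W).
  { intros z Hz Hz0; change (cdiff W z); unfold W.
    pose proof (Hp z Hz : cdiff p z).
    assert (Hi : cdiff (fun w => / w)%cpl z) by (apply cdiff_inv; [apply cdiff_id|exact Hz0]).
    apply cdiff_mul; [assumption|].
    apply cdiff_sub; [apply cdiff_sub; [apply cdiff_const|]|]; apply cdiff_mul;
      try apply cdiff_const; apply cdiff_mul; try assumption; apply cdiff_id. }
  assert (HWT : forall z, z <> C0 -> W z = (T z - S z)%cpl).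
  { intros z Hz; unfold W, T, S, al; rewrite !Ek; field; exact Hz. }
  assert (CT : cont0 T) by (unfold T; solve_cont0).
  assert (T0 : fst (T C0) = 2 - r ^ 2 * fst (c * p2)%cpl).
  { unfold T, al; rewrite p0, k0; unfold Csub, Cadd, Copp, Cmul, RtoC, C1, C0; simpl; ring. }
  pose proof PI_RGT_0 as HPI.
  assert (HWr : 0 <= RInt (fun t => fst (W (circ r t))) 0 (2 * PI)).
  { apply RInt_ge_0; [lra|apply ex_RInt_circle; assumption|]; intros t _.
    assert (HinU : inU (circ r t)) by (unfold inU; rewrite Cmod_circ; lra).
    specialize (Hre _ HinU).
    set (w := (c * (circ 1 (- t) * circ 1 (- t)))%cpl).
    assert (Hw : fst w <= 1).
    { eapply Rle_trans; [apply Rle_abs|]; eapply Rle_trans; [apply Rabs_fst_le|].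
      unfold w; rewrite !Cmod_mul, !Cmod_circ, Hc; lra. }
    assert (E : W (circ r t) = (p (circ r t) * RtoC (2 - 2 * fst w))%cpl).
    { unfold W; f_equal; unfold w; rewrite circ_inv by lra.
      unfold circ, Csub, Copp, Cadd, Cmul, RtoC, Cconj; cbn [fst snd].
      rewrite cos_neg, sin_neg; f_equal; field; lra. }
    rewrite E; unfold Cmul, RtoC; cbn [fst snd]; nra. }
  apply Rnot_lt_le; intros Hlt.
  (* If [Re (T C0) = - 2 eta] were negative, [Re T] would stay below [- eta] on a small circle. As
     [S] has mean zero there, the mean of [Re W] would be negative. *)
  set (eta := - fst (T C0) / 2).
  assert (Heta : eta > 0) by (unfold eta; lra).
  destruct (CT eta Heta) as (del & Hdel & HT).
  set (rho := Rmin r (del / 2)).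
  assert (Hrho : 0 < rho) by (apply Rmin_pos; lra).
  assert (Hrr : rho <= r) by apply Rmin_l.
  assert (Hrd : rho < del) by (pose proof (Rmin_r r (del / 2)); unfold rho; lra).
  rewrite <- (circle_mean W rho r) in HWr by (trivial; lra).
  assert (Hex : ex_RInt (fun t => fst (W (circ rho t))) 0 (2 * PI)).
  { apply ex_RInt_circle; [assumption|lra]. }
  assert (HS : is_RInt (fun t => fst (S (circ rho t))) 0 (2 * PI) 0)
    by exact (is_RInt_circle_pole al (al * p1)%cpl rho Hrho).
  assert (HWS : RInt (fun t => fst (W (circ rho t)) + fst (S (circ rho t))) 0 (2 * PI)
     = RInt (fun t => fst (W (circ rho t))) 0 (2 * PI)).
  { etransitivity.
    - apply (RInt_plus (V := R_CompleteNormedModule)); [exact Hex|].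
      eexists; exact HS.
    - rewrite (is_RInt_unique _ _ _ _ HS); unfold plus; simpl; ring. }
  rewrite <- HWS in HWr.
  assert (Hup : RInt (fun t => fst (W (circ rho t)) + fst (S (circ rho t))) 0 (2 * PI)
     <= RInt (fun _ => - eta) 0 (2 * PI)).
  { apply RInt_le; [lra| |apply ex_RInt_const|].
    - apply (ex_RInt_plus (V := R_NormedModule)); [exact Hex|].
      eexists; exact HS.
    - intros t _; rewrite HWT by (apply circ_neq_C0; exact Hrho).
      specialize (HT (circ rho t)); rewrite Cmod_circ in HT by lra.
      specialize (HT Hrd).
      pose proof (Rabs_fst_le (T (circ rho t) - T C0)%cpl) as Hf.
      pose proof (Rle_abs (fst (T (circ rho t) - T C0)%cpl)) as Hg.
      unfold Csub, Cadd, Copp in *; cbn [fst snd] in *; unfold eta in *; lra. }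
  rewrite RInt_const in Hup; unfold scal in Hup; simpl in Hup; unfold mult in Hup; simpl in Hup.
  pose proof (Rle_trans _ _ _ HWr Hup).
  pose proof (Rmult_lt_0_compat _ _ HPI Heta); lra.
Qed.

(** The unimodular [c] rotates [p2] onto the positive axis, turning the bound on a real part into
    one on the modulus; the factor [r^2] is removed by taking [r] close to [1]. *)
Lemma caratheodory2 (p : C -> C) (p1 p2 : C) :
  analytic_on_U p -> (forall z, inU z -> 0 <= fst (p z)) -> taylor2 p C1 p1 p2 -> Cmod p2 <= 2.
Proof.
  intros Hp Hre Ht.
  destruct (C_eq_dec p2 C0) as [->|Hne]; [rewrite Cmod_C0; lra|].
  pose proof (Cmod_pos _ Hne) as Hpos.
  set (c := (RtoC (/ Cmod p2) * Cconj p2)%cpl).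
  assert (Hc : Cmod c = 1).
  { unfold c; rewrite Cmod_mul, Cmod_RtoC, Rabs_right by (left; apply Rinv_0_lt_compat; exact Hpos).
    replace (Cmod (Cconj p2)) with (Cmod p2) by (symmetry; exact (Complex.Cmod_conj p2)).
    field; lra. }
  assert (Hcp : fst (c * p2)%cpl = Cmod p2).
  { transitivity (/ Cmod p2 * (fst p2 ^ 2 + snd p2 ^ 2)).
    - unfold c, Cmul, RtoC, Cconj; simpl; ring.
    - rewrite <- Cmod_sqr; field; lra. }
  apply Rnot_lt_le; intros Hlt.
  set (m := Cmod p2) in *.
  (* The midpoint of [2 / m] and [1]: the arithmetic mean exceeds the geometric mean, so
     [r^2 > 2 / m], against [r^2 m <= 2]. *)
  set (r := (1 + 2 / m) / 2).
  assert (Hm : 0 < 2 / m < 1).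
  { split; [apply Rdiv_lt_0_compat; lra|].
    apply (Rmult_lt_reg_r m); [lra|]; unfold Rdiv; rewrite Rmult_assoc, Rinv_l; lra. }
  pose proof (caratheodory_aux p p1 p2 c r Hp Hre Ht Hc ltac:(unfold r; lra)) as H.
  rewrite Hcp in H.
  assert (E : 2 = 2 / m * m) by (field; lra).
  assert (2 / m < r ^ 2) by (unfold r; nra).
  nra.
Qed.

(** The Cayley map [A y = (1 + y) / (1 - y)] sends the disc to the right half-plane, with
    [Re (A y) = (1 - |y|^2) / |1 - y|^2]. *)
Lemma schwarz_coef2 (w : C -> C) (u1 u2 : C) :
  analytic_on_U w -> (forall z, inU z -> inU (w z)) -> taylor2 w C0 u1 u2 ->
  Cmod (u2 + u1 * u1)%cpl <= 1.
Proof.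
  intros Hw Hin Ht.
  assert (Hne : forall z, inU z -> (C1 - z)%cpl <> C0).
  { intros z Hz E; unfold inU in Hz.
    assert (E1 : z = C1) by (replace z with (C1 - (C1 - z))%cpl by ring; rewrite E; ring).
    rewrite E1, Cmod_C1 in Hz; lra. }
  set (A := fun y => ((C1 + y) * / (C1 - y))%cpl).
  assert (HA : taylor2 A C1 (RtoC 2) (RtoC 2)).
  { apply (taylor2_ext (fun y => C1 + RtoC 2 * y + (RtoC 2 * / (C1 - y)) * (y * y))%cpl).
    - generalize near0_inU; apply near0_imp; intros y Hy; unfold A.
      replace (RtoC 2) with (C1 + C1)%cpl
        by (unfold C1, Cadd, RtoC; simpl; f_equal; ring).
      field; apply Hne, Hy.
    - exists (fun y => RtoC 2 * / (C1 - y))%cpl; split; [|split; [|reflexivity]].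
      + apply cont0_mul; [solve_cont0|apply cont0_inv; [solve_cont0|]].
        apply Hne; unfold inU; rewrite Cmod_C0; lra.
      + replace (C1 - C0)%cpl with C1 by ring; field; exact C1_neq_C0. }
  pose proof (taylor2_comp A w _ _ _ _ _ HA Ht) as Hp.
  assert (Hb : Cmod (RtoC 2 * u2 + RtoC 2 * (u1 * u1))%cpl <= 2).
  { apply (caratheodory2 (fun z => A (w z)) (RtoC 2 * u1)%cpl); [| |exact Hp].
    - intros z Hz; change (cdiff (fun z => A (w z)) z); unfold A.
      pose proof (Hw z Hz : cdiff w z).
      apply cdiff_mul; [apply cdiff_add; [apply cdiff_const|assumption]|].
      apply cdiff_inv; [apply cdiff_sub; [apply cdiff_const|assumption]|].
      apply Hne, Hin, Hz.
    - intros z Hz; specialize (Hin z Hz); unfold inU in Hin.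
      pose proof (Cmod_nonneg (w z)).
      assert (Hs : Cmod (w z) ^ 2 < 1) by nra; rewrite Cmod_sqr in Hs.
      unfold A, Cmul, Cinv, Cadd, Csub, Cadd, Copp, C1; cbn [fst snd].
      destruct (w z) as [x y]; cbn [fst snd] in *.
      assert (Hx : x < 1) by nra.
      set (N := (1 + - x) ^ 2 + (0 + - y) ^ 2).
      assert (HN : 0 < N) by (unfold N; nra).
      match goal with |- 0 <= ?e => replace e with ((1 - x ^ 2 - y ^ 2) / N) by (field; lra) end.
      apply Rdiv_le_0_compat; lra. }
  replace (RtoC 2 * u2 + RtoC 2 * (u1 * u1))%cpl with (RtoC 2 * (u2 + u1 * u1))%cpl in Hb by ring.
  rewrite Cmod_mul, Cmod_RtoC, Rabs_right in Hb by lra; lra.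
Qed.

(** * Power series *)

Lemma Cmod_le_epsilon (z : C) (b : R) : (forall eps, eps > 0 -> Cmod z <= b + eps) -> Cmod z <= b.
Proof. intros H; apply le_epsilon; intros eps Heps; apply H, Heps. Qed.

Lemma Cpow_sub_le (z w : C) (rho : R) (n : nat) :
  Cmod z <= rho -> Cmod w <= rho ->
  Cmod (Cpow z (S n) - Cpow w (S n))%cpl <= INR (S n) * rho ^ n * Cmod (z - w)%cpl.
Proof.
  intros Hz Hw; pose proof (Cmod_nonneg z) as Pz; pose proof (Cmod_nonneg w) as Pw.
  induction n as [|n IH].
  - simpl; replace (z * C1 - w * C1)%cpl with (z - w)%cpl by ring; lra.
  - replace (Cpow z (S (S n)) - Cpow w (S (S n)))%cpl
      with (z * (Cpow z (S n) - Cpow w (S n)) + (z - w) * Cpow w (S n))%cpl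
      by (cbn [Cpow]; ring).
    eapply Rle_trans; [apply Cmod_add_le|]; rewrite !Cmod_mul.
    assert (Hp : Cmod (Cpow w (S n)) <= rho ^ S n).
    { generalize (S n); intros j; induction j as [|j IHj]; simpl.
      - rewrite Cmod_C1; lra.
      - rewrite Cmod_mul; apply Rmult_le_compat; auto using Cmod_nonneg. }
    pose proof (Cmod_nonneg (z - w)%cpl) as Pd.
    rewrite (S_INR (S n)).
    apply Rle_trans with (rho * (INR (S n) * rho ^ n * Cmod (z - w)%cpl)
                          + Cmod (z - w)%cpl * rho ^ S n).
    + apply Rplus_le_compat; apply Rmult_le_compat; auto using Cmod_nonneg; lra.
    + right; simpl; ring.
Qed.

Lemma Cpow_RtoC (x : R) (n : nat) : Cpow (RtoC x) n = RtoC (x ^ n).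
Proof.
  induction n as [|n IH]; [reflexivity|]; cbn [Cpow pow]; rewrite IH, RtoC_mul; reflexivity.
Qed.

(** Convergence at the point [1 / 2]: beyond some rank two consecutive partial sums are within [1]
    of the limit, so the terms are at most [2] in modulus; the finitely many earlier coefficients
    enlarge [M]. *)
Lemma power_series_coef_bound (f : C -> C) (a : nat -> C) :
  power_series_on_U f a -> exists M, 0 <= M /\ forall n, Cmod (a n) <= M * 2 ^ n.
Proof.
  intros Hf.
  assert (Hh : inU (RtoC (/ 2))) by (unfold inU; rewrite Cmod_RtoC, Rabs_right; lra).
  destruct (Hf _ Hh 1 ltac:(lra)) as [N HN].
  assert (HM : forall n, exists M, 0 <= M /\ forall i, (i <= n)%nat -> Cmod (a i) <= M * 2 ^ i).
  { induction n as [|n (M & HM0 & HM)].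
    - exists (Cmod (a O)); split; [apply Cmod_nonneg|]; intros i Hi.
      replace i with O by lia; simpl; lra.
    - exists (M + Cmod (a (S n))); pose proof (Cmod_nonneg (a (S n))); split; [lra|].
      intros i Hi; pose proof (pow_R1_Rle 2 i ltac:(lra)).
      destruct (Nat.eq_dec i (S n)) as [->|Hne].
      + nra.
      + specialize (HM i ltac:(lia)); nra. }
  destruct (HM N) as (M & HM0 & HMN); exists (M + 2); split; [lra|]; intros n.
  pose proof (pow_R1_Rle 2 n ltac:(lra)).
  destruct (Nat.le_gt_cases n N) as [Hle|Hgt]; [specialize (HMN n Hle); nra|].
  destruct n as [|n]; [lia|].
  pose proof (HN n ltac:(lia)) as H1; pose proof (HN (S n) ltac:(lia)) as H2.
  cbn [Cpsum] in H2.
  assert (H3 : Cmod (a (S n) * Cpow (RtoC (/ 2)) (S n))%cpl <= 2).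
  { match type of H2 with Cmod (?s + ?t - ?l)%cpl < 1 =>
      replace t with ((s + t - l) - (s - l))%cpl by ring end.
    eapply Rle_trans; [apply Cmod_sub_le|]; lra. }
  rewrite Cpow_RtoC, Cmod_mul, Cmod_RtoC, pow_inv, Rabs_right in H3
    by (apply Rle_ge, Rlt_le, Rinv_0_lt_compat; lra).
  apply (Rmult_le_compat_r (2 ^ S n)) in H3; [|lra].
  rewrite Rmult_assoc, Rinv_l in H3 by lra.
  nra.
Qed.

Lemma INR_le_pow2 (n : nat) : INR n <= 2 ^ n.
Proof.
  induction n as [|n IH]; [simpl; lra|].
  rewrite S_INR; simpl; pose proof (pow_R1_Rle 2 n ltac:(lra)); lra.
Qed.

(** A single Lipschitz estimate of the tail serves three purposes: with [w = 0] it bounds the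
    remainder, letting [w] approach [z] it bounds the derivative of the remainder, and for [m = 1]
    it gives a contraction. The term of degree [j] is at most [M 2^j * j rho^(j-1) * |z - w|]; as
    [j <= 2^j] and [rho <= 1/8], successive bounds decrease with ratio [4 / 8 = 1/2]. *)
Lemma power_series_rem_lipschitz (f : C -> C) (a : nat -> C) (m : nat) :
  power_series_on_U f a -> exists K, 0 <= K /\ forall rho z w,
    rho <= / 8 -> Cmod z <= rho -> Cmod w <= rho ->
    Cmod ((f z - Cpsum a z m) - (f w - Cpsum a w m))%cpl <= K * rho ^ m * Cmod (z - w)%cpl.
Proof.
  intros Hf; destruct (power_series_coef_bound f a Hf) as (M & HM0 & HM).
  exists (2 * (M * 4 ^ S m)); split.
  { pose proof (pow_le 4 (S m) ltac:(lra)); nra. }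
  intros rho z w Hrho Hz Hw.
  pose proof (Cmod_nonneg z); pose proof (Cmod_nonneg (z - w)%cpl) as Pd.
  assert (Hr0 : 0 <= rho) by lra.
  set (B := M * 4 ^ S m * rho ^ m * Cmod (z - w)%cpl).
  assert (HB : 0 <= B).
  { unfold B; apply Rmult_le_pos; [apply Rmult_le_pos; [apply Rmult_le_pos|]|];
      trivial; apply pow_le; lra. }
  assert (Hpart : forall n,
    Cmod ((Cpsum a z (m + n) - Cpsum a z m) - (Cpsum a w (m + n) - Cpsum a w m))%cpl
    <= B * (2 - 2 * (/ 2) ^ n)).
  { induction n as [|n IH].
    - rewrite Nat.add_0_r.
      match goal with |- Cmod ?e <= _ => replace e with C0 by ring end.
      rewrite Cmod_C0; simpl; lra.
    - rewrite Nat.add_succ_r; cbn [Cpsum].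
      match goal with |- Cmod ((?s + ?c * ?p - ?t) - (?s' + ?c * ?p' - ?t'))%cpl <= _ =>
        replace ((s + c * p - t) - (s' + c * p' - t'))%cpl
        with (((s - t) - (s' - t')) + c * (p - p'))%cpl by ring end.
      eapply Rle_trans; [apply Cmod_add_le|].
      assert (Hterm : Cmod (a (S (m + n)) * (Cpow z (S (m + n)) - Cpow w (S (m + n))))%cpl
                      <= B * (/ 2) ^ n).
      { rewrite Cmod_mul.
        eapply Rle_trans; [apply Rmult_le_compat;
          [apply Cmod_nonneg|apply Cmod_nonneg|apply HM|apply Cpow_sub_le; eassumption]|].
        set (j := S (m + n)).
        apply Rle_trans with (M * 2 ^ j * (2 ^ j * (rho ^ m * (/ 8) ^ n) * Cmod (z - w)%cpl)).
        - apply Rmult_le_compat_l; [apply Rmult_le_pos; [exact HM0|apply pow_le; lra]|].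
          apply Rmult_le_compat_r; [exact Pd|].
          rewrite pow_add.
          apply Rmult_le_compat; [apply pos_INR| |apply INR_le_pow2|].
          + apply Rmult_le_pos; apply pow_le; lra.
          + apply Rmult_le_compat_l; [apply pow_le; lra|apply pow_incr; lra].
        - right; unfold B.
          assert (E : 2 ^ j * 2 ^ j * (/ 8) ^ n = 4 ^ S m * (/ 2) ^ n).
          { rewrite <- Rpow_mult_distr; replace (2 * 2) with 4 by ring.
            unfold j; replace (S (m + n)) with (S m + n)%nat by lia.
            rewrite pow_add, Rmult_assoc, <- Rpow_mult_distr.
            replace (4 * / 8) with (/ 2) by field; reflexivity. }
          transitivity (M * (2 ^ j * 2 ^ j * (/ 8) ^ n) * rho ^ m * Cmod (z - w)%cpl); [ring|].
          rewrite E; ring. }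
      assert (E : (/ 2) ^ S n = / 2 * (/ 2) ^ n) by reflexivity.
      rewrite E; lra. }
  replace (2 * (M * 4 ^ S m) * rho ^ m * Cmod (z - w)%cpl) with (B * 2) by (unfold B; ring).
  apply Cmod_le_epsilon; intros eps Heps.
  assert (Hzu : inU z) by (unfold inU; lra); assert (Hwu : inU w) by (unfold inU; lra).
  destruct (Hf z Hzu (eps / 2) ltac:(lra)) as [N1 H1].
  destruct (Hf w Hwu (eps / 2) ltac:(lra)) as [N2 H2].
  set (n := (N1 + N2)%nat).
  specialize (H1 (m + n)%nat ltac:(lia)); specialize (H2 (m + n)%nat ltac:(lia)).
  specialize (Hpart n).
  match goal with |- Cmod ?e <= _ => replace e with
    (((Cpsum a z (m + n) - Cpsum a z m) - (Cpsum a w (m + n) - Cpsum a w m))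
     - ((Cpsum a z (m + n) - f z) - (Cpsum a w (m + n) - f w)))%cpl by ring end.
  eapply Rle_trans; [apply Cmod_sub_le|].
  eapply Rle_trans; [apply Rplus_le_compat_l, Cmod_sub_le|].
  assert (0 <= B * (/ 2) ^ n) by (apply Rmult_le_pos; [exact HB|apply pow_le; lra]).
  lra.
Qed.

Lemma Cpsum_0 (a : nat -> C) (n : nat) : Cpsum a C0 n = a O.
Proof. induction n as [|n IH]; cbn [Cpsum Cpow]; [reflexivity|]; rewrite IH; ring. Qed.

Lemma power_series_at0 (f : C -> C) (a : nat -> C) : power_series_on_U f a -> f C0 = a O.
Proof.
  intros Hf.
  assert (E : (a O - f C0)%cpl = C0).
  { apply Cmod_zero, Rle_antisym; [|apply Cmod_nonneg].
    apply Cmod_le_epsilon; intros eps Heps.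
    destruct (Hf C0 (near0_at _ near0_inU) eps Heps) as [N HN].
    specialize (HN N (le_n N)); rewrite Cpsum_0 in HN; lra. }
  replace (a O) with (f C0 + (a O - f C0))%cpl by ring; rewrite E; ring.
Qed.

Lemma power_series_rem (f : C -> C) (a : nat -> C) (m : nat) :
  power_series_on_U f a -> exists K, 0 <= K /\ forall z, Cmod z <= / 8 ->
    Cmod (f z - Cpsum a z m)%cpl <= K * Cmod z ^ S m.
Proof.
  intros Hf; destruct (power_series_rem_lipschitz f a m Hf) as (K & HK0 & HK).
  exists K; split; [exact HK0|]; intros z Hz.
  specialize (HK (Cmod z) z C0 Hz (Rle_refl _)).
  rewrite Cmod_C0, Cpsum_0, (power_series_at0 f a Hf) in HK.
  replace (f z - Cpsum a z m - (a O - a O))%cpl with (f z - Cpsum a z m)%cpl in HK by ring.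
  replace (z - C0)%cpl with z in HK by ring.
  eapply Rle_trans; [apply HK, Cmod_nonneg|]; right; simpl; ring.
Qed.

Lemma near0_le (r : R) : r > 0 -> near0 (fun z => Cmod z <= r).
Proof. intros Hr; exists r; split; [exact Hr|]; intros; lra. Qed.

Lemma power_series_taylor2 (f : C -> C) (a : nat -> C) :
  power_series_on_U f a -> taylor2 f (a O) (a 1%nat) (a 2%nat).
Proof.
  intros Hf; destruct (power_series_rem f a 2 Hf) as (K & HK0 & HK).
  apply (taylor2_of_cubic _ _ _ _ K).
  generalize (near0_le (/ 8) ltac:(lra)); apply near0_imp; intros z Hz.
  specialize (HK z Hz); cbn [Cpsum Cpow] in HK.
  replace (a O + a 1%nat * z + a 2%nat * (z * z))%cpl
    with (a O + a 1%nat * (z * C1) + a 2%nat * (z * (z * C1)))%cpl by ring.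
  exact HK.
Qed.

Lemma Cderiv_le (F : C -> C) (z d : C) (M : R) :
  Cderiv F z d -> near0 (fun u => Cmod (F (z + u) - F z)%cpl <= M * Cmod u) -> Cmod d <= M.
Proof.
  intros Hd HM; apply Cderiv_factor in Hd as (k & Hk & <- & Ek).
  apply Rnot_lt_le; intros Hlt.
  destruct (near0_and _ _ HM (Hk (Cmod (k C0) - M) ltac:(lra))) as (del & Hdel & H).
  assert (Hu : Cmod (RtoC (del / 2)) = del / 2) by (rewrite Cmod_RtoC, Rabs_right; lra).
  set (u := RtoC (del / 2)) in *.
  destruct (H u ltac:(lra)) as [H1 H2].
  rewrite Ek in H1; replace (F z + k u * u - F z)%cpl with (k u * u)%cpl in H1 by ring.
  rewrite Cmod_mul, Hu in H1.
  assert (Cmod (k C0) <= Cmod (k C0 - k u)%cpl + Cmod (k u)).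
  { replace (k C0) with ((k C0 - k u) + k u)%cpl at 1 by ring; apply Cmod_add_le. }
  rewrite Cmod_sub_sym in H2; nra.
Qed.

(** Replaces termwise differentiation. The error in [f'] is the derivative of the tail past degree
    three, hence bounded by the Lipschitz constant [K (|z| + e)^3] of that tail on the disc of
    radius [|z| + e]. *)
Lemma power_series_deriv_taylor2 (f f' : C -> C) (a : nat -> C) :
  power_series_on_U f a -> deriv_on_U f f' ->
  taylor2 f' (a 1%nat) (RtoC 2 * a 2%nat)%cpl (RtoC 3 * a 3%nat)%cpl.
Proof.
  intros Hf Hf'; destruct (power_series_rem_lipschitz f a 3 Hf) as (K & HK0 & HK).
  apply (taylor2_of_cubic _ _ _ _ (K * 2 ^ 3)).
  generalize (near0_le (/ 16) ltac:(lra)); apply near0_imp; intros z Hz.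
  set (d := (f' z - _)%cpl).
  assert (Hd : Cderiv (fun z => f z - Cpsum a z 3)%cpl z d).
  { unfold d; apply Cderiv_sub; [apply Hf'; unfold inU; lra|].
    apply Cderiv_factor; exists (fun u => a 1%nat + a 2%nat * (RtoC 2 * z + u)
       + a 3%nat * (RtoC 3 * (z * z) + RtoC 3 * z * u + u * u))%cpl.
    split; [solve_cont0|split; [ring|]].
    intros u; cbn [Cpsum Cpow].
    replace (RtoC 3) with (C1 + C1 + C1)%cpl by (unfold C1, Cadd, RtoC; simpl; f_equal; ring).
    replace (RtoC 2) with (C1 + C1)%cpl by (unfold C1, Cadd, RtoC; simpl; f_equal; ring).
    ring. }
  assert (Hb : forall e, 0 < e <= / 16 -> Cmod d <= K * (Cmod z + e) ^ 3).
  { intros e He; apply (Cderiv_le _ z d _ Hd).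
    generalize (near0_le e ltac:(lra)); apply near0_imp; intros u Hu.
    pose proof (Cmod_add_le z u).
    eapply Rle_trans; [apply (HK (Cmod z + e)); lra|].
    right; do 2 f_equal; ring. }
  (* Away from the origin [e = |z|] gives the constant [K * 2^3]; at the origin that choice
     degenerates and [e] tends to [0] instead. *)
  destruct (C_eq_dec z C0) as [->|Hne].
  - rewrite Cmod_C0 in *.
    apply Cmod_le_epsilon; intros eps Heps.
    set (e := Rmin (/ 16) (eps / (K + 1))).
    assert (He : 0 < e) by (apply Rmin_pos; [lra|apply Rdiv_lt_0_compat; lra]).
    assert (He1 : e <= / 16) by apply Rmin_l.
    assert (HKe : (K + 1) * e <= eps).
    { apply Rle_trans with ((K + 1) * (eps / (K + 1))); [|right; field; lra].
      apply Rmult_le_compat_l; [lra|apply Rmin_r]. }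
    eapply Rle_trans; [apply (Hb e); lra|].
    assert (e ^ 3 <= e) by (assert (e * e <= 1) by nra; simpl; nra).
    rewrite Rplus_0_l; nra.
  - pose proof (Cmod_pos _ Hne).
    eapply Rle_trans; [apply (Hb (Cmod z)); lra|]; right; ring.
Qed.

(** * Local surjectivity *)

Lemma C_complete (z : nat -> C) :
  (forall eps, eps > 0 -> exists N, forall n m, (n >= N)%nat -> (m >= N)%nat ->
     Cmod (z n - z m)%cpl < eps) ->
  exists l, forall eps, eps > 0 -> exists N, forall n, (n >= N)%nat -> Cmod (z n - l)%cpl < eps.
Proof.
  intros H.
  destruct (R_complete (fun n => fst (z n))) as [l1 H1].
  { intros eps Heps; destruct (H eps Heps) as [N HN]; exists N; intros n m Hn Hm.
    exact (Rle_lt_trans _ _ _ (Rabs_fst_le (z n - z m)%cpl) (HN n m Hn Hm)). }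
  destruct (R_complete (fun n => snd (z n))) as [l2 H2].
  { intros eps Heps; destruct (H eps Heps) as [N HN]; exists N; intros n m Hn Hm.
    exact (Rle_lt_trans _ _ _ (Rabs_snd_le (z n - z m)%cpl) (HN n m Hn Hm)). }
  exists (l1, l2); intros eps Heps.
  destruct (H1 (eps / 2) ltac:(lra)) as [N1 HN1].
  destruct (H2 (eps / 2) ltac:(lra)) as [N2 HN2].
  exists (N1 + N2)%nat; intros n Hn.
  specialize (HN1 n ltac:(lia)); specialize (HN2 n ltac:(lia)).
  eapply Rle_lt_trans; [apply Cmod_le_2Rmax|].
  pose proof (Rmax_lub_lt _ _ _ HN1 HN2) as Hm; unfold Rdist in Hm.
  unfold Csub, Cadd, Copp; cbn [fst snd]; unfold Rminus in *; lra.
Qed.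

(** Picard iteration of [z |-> w - Rm z] from [0]. Since [Rm] vanishes at [0] and halves distances,
    and [|w| <= rho / 2], the disc of radius [rho] is mapped into itself. *)
Lemma contraction_solve (Rm : C -> C) (rho : R) (w : C) :
  Rm C0 = C0 ->
  (forall z z', Cmod z <= rho -> Cmod z' <= rho ->
     Cmod (Rm z - Rm z')%cpl <= / 2 * Cmod (z - z')%cpl) ->
  Cmod w <= rho / 2 -> exists z, Cmod z <= rho /\ (z + Rm z)%cpl = w.
Proof.
  intros R0 HR Hw.
  pose proof (Cmod_nonneg w) as Pw.
  set (z := fix z n := match n with O => C0 | S m => (w - Rm (z m))%cpl end).
  assert (Hz : forall n, Cmod (z n) <= rho).
  { induction n as [|n IH]; cbn [z]; [rewrite Cmod_C0; lra|].
    eapply Rle_trans; [apply Cmod_sub_le|].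
    assert (H0 : Cmod C0 <= rho) by (rewrite Cmod_C0; lra).
    specialize (HR (z n) C0 IH H0); rewrite R0 in HR.
    replace (Rm (z n) - C0)%cpl with (Rm (z n)) in HR by ring.
    replace (z n - C0)%cpl with (z n) in HR by ring; lra. }
  assert (Hk : forall n k, Cmod (z (n + k)%nat - z n)%cpl <= (/ 2) ^ n * rho).
  { induction n as [|n IH]; intros k.
    - cbn [z]; replace (z (0 + k)%nat - C0)%cpl with (z k) by (simpl; ring).
      specialize (Hz k); simpl; lra.
    - change (S n + k)%nat with (S (n + k)); cbn [z].
      replace (w - Rm (z (n + k)%nat) - (w - Rm (z n)))%cpl
        with (Rm (z n) - Rm (z (n + k)%nat))%cpl by ring.
      eapply Rle_trans; [apply HR; apply Hz|].
      rewrite Cmod_sub_sym; specialize (IH k); simpl; lra. }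
  assert (Hp : forall eps, eps > 0 -> exists N, forall n, (n >= N)%nat -> (/ 2) ^ n * rho < eps).
  { intros eps Heps.
    destruct (pow_lt_1_zero (/ 2)) with (y := eps / (rho + 1)) as [N HN].
    { rewrite Rabs_right; lra. }
    { apply Rdiv_lt_0_compat; lra. }
    exists N; intros n Hn; specialize (HN n Hn).
    assert (0 <= (/ 2) ^ n) by (apply pow_le; lra).
    rewrite Rabs_right in HN by lra.
    apply (Rmult_lt_compat_r (rho + 1)) in HN; [|lra].
    replace (eps / (rho + 1) * (rho + 1)) with eps in HN by (field; lra); lra. }
  destruct (C_complete z) as [l Hl].
  { intros eps Heps; destruct (Hp (eps / 2) ltac:(lra)) as [N HN]; exists N; intros n m Hn Hm.
    specialize (HN N (le_n N)).
    pose proof (Hk N (n - N)%nat) as K1; pose proof (Hk N (m - N)%nat) as K2.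
    replace (N + (n - N))%nat with n in K1 by lia; replace (N + (m - N))%nat with m in K2 by lia.
    replace (z n - z m)%cpl with ((z n - z N) - (z m - z N))%cpl by ring.
    eapply Rle_lt_trans; [apply Cmod_sub_le|lra]. }
  assert (Hlr : Cmod l <= rho).
  { apply Cmod_le_epsilon; intros eps Heps; destruct (Hl eps Heps) as [N HN].
    specialize (HN N (le_n N)); specialize (Hz N).
    replace l with (z N - (z N - l))%cpl by ring.
    eapply Rle_trans; [apply Cmod_sub_le|lra]. }
  exists l; split; [exact Hlr|].
  assert (E : (l + Rm l - w)%cpl = C0).
  { apply Cmod_zero, Rle_antisym; [|apply Cmod_nonneg].
    apply Cmod_le_epsilon; intros eps Heps; destruct (Hl (eps / 2) ltac:(lra)) as [N HN].
    pose proof (HN N (le_n N)) as H1; pose proof (HN (S N) (Nat.le_succ_diag_r N)) as H2.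
    pose proof (HR (z N) l (Hz N) Hlr) as H3.
    cbn [z] in H2; fold (z N) in H2.
    replace (l + Rm l - w)%cpl with (- ((w - Rm (z N) - l) + (Rm (z N) - Rm l)))%cpl by ring.
    rewrite Cmod_copp; eapply Rle_trans; [apply Cmod_add_le|lra]. }
  replace (l + Rm l)%cpl with ((l + Rm l - w) + w)%cpl by ring; rewrite E; ring.
Qed.

(** Since [f z = z + (tail)], solving [f z = w] is a fixed point problem for the tail past degree
    one. This is what turns a left inverse of [f] near the origin into a two-sided one. *)
Lemma power_series_local_onto (f : C -> C) (a : nat -> C) (r : R) :
  power_series_on_U f a -> a O = C0 -> a 1%nat = C1 -> r > 0 ->
  near0 (fun w => exists z, Cmod z < r /\ f z = w).
Proof.
  intros Hf a0 a1 Hr.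
  destruct (power_series_rem_lipschitz f a 1 Hf) as (K & HK0 & HK).
  (* Three demands: solutions stay within radius [r], the tail estimate applies ([rho <= 1/8]), and
     the Lipschitz constant [K rho] is at most [1/2]. *)
  set (rho := Rmin (r / 2) (Rmin (/ 8) (/ (2 * (K + 1))))).
  assert (HKi : 0 < / (2 * (K + 1))) by (apply Rinv_0_lt_compat; lra).
  assert (Hrho : 0 < rho) by (repeat apply Rmin_pos; lra).
  pose proof (Rmin_l (r / 2) (Rmin (/ 8) (/ (2 * (K + 1))))) as E1.
  pose proof (Rmin_r (r / 2) (Rmin (/ 8) (/ (2 * (K + 1))))) as E2.
  pose proof (Rmin_l (/ 8) (/ (2 * (K + 1)))) as E3.
  pose proof (Rmin_r (/ 8) (/ (2 * (K + 1)))) as E4.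
  fold rho in E1, E2.
  assert (HKr : K * rho <= / 2).
  { apply Rle_trans with ((K + 1) * / (2 * (K + 1))); [|right; field; lra].
    apply Rmult_le_compat; lra. }
  generalize (near0_le (rho / 2) ltac:(lra)); apply near0_imp; intros w Hw.
  destruct (contraction_solve (fun z => f z - Cpsum a z 1)%cpl rho w) as (z & Hz & E).
  - rewrite Cpsum_0, (power_series_at0 f a Hf); ring.
  - intros z z' Hz Hz'; eapply Rle_trans; [apply (HK rho); lra|].
    rewrite pow_1; apply Rmult_le_compat_r; [apply Cmod_nonneg|exact HKr].
  - exact Hw.
  - exists z; split; [lra|]; rewrite <- E; cbn [Cpsum Cpow]; rewrite a0, a1; ring.
Qed.

(** * Coefficients of the inverse function and of the subordinations *)

Lemma RtoC_2 : RtoC 2 = (C1 + C1)%cpl.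
Proof. unfold C1, Cadd, RtoC; simpl; f_equal; ring. Qed.

Lemma RtoC_3 : RtoC 3 = (C1 + C1 + C1)%cpl.
Proof. unfold C1, Cadd, RtoC; simpl; f_equal; ring. Qed.

Lemma two_neq_C0 : (C1 + C1)%cpl <> C0.
Proof. rewrite <- RtoC_2; apply RtoC_neq_C0; lra. Qed.

Lemma RtoC_div (x y : R) : y <> 0 -> RtoC (x / y) = (RtoC x / RtoC y)%cpl.
Proof. exact (Complex.RtoC_div x y). Qed.

Lemma taylor2_eq (F : C -> C) (c0 c1 c2 c0' c1' c2' : C) :
  taylor2 F c0 c1 c2 -> c0 = c0' -> c1 = c1' -> c2 = c2' -> taylor2 F c0' c1' c2'.
Proof. intros H <- <- <-; exact H. Qed.

Lemma taylor2_inv (F : C -> C) (c1 c2 : C) :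
  taylor2 F C1 c1 c2 -> taylor2 (fun z => / F z)%cpl C1 (- c1)%cpl (c1 * c1 - c2)%cpl.
Proof.
  intros HF.
  assert (HA : taylor2 (fun y => / (C1 + y))%cpl C1 (- C1)%cpl C1).
  { assert (Hc : cont0 (fun y => C1 + y)%cpl) by solve_cont0.
    assert (H0 : (C1 + C0)%cpl <> C0) by (replace (C1 + C0)%cpl with C1 by ring; exact C1_neq_C0).
    apply (taylor2_ext (fun y => C1 + - C1 * y + / (C1 + y) * (y * y))%cpl).
    - generalize (cont0_near_neq _ Hc H0); apply near0_imp; intros y Hy.
      field; exact Hy.
    - exists (fun y => / (C1 + y))%cpl; split; [apply cont0_inv; assumption|].
      split; [|reflexivity]; replace (C1 + C0)%cpl with C1 by ring; field; exact C1_neq_C0. }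
  apply (taylor2_ext (fun z => / (C1 + (F z + - C1)))%cpl).
  { exists 1; split; [lra|]; intros z _; f_equal; ring. }
  eapply taylor2_eq.
  - eapply (taylor2_comp (fun y => / (C1 + y))%cpl (fun z => F z + - C1)%cpl _ _ _ _ _ HA).
    eapply taylor2_eq; [exact (taylor2_add _ _ _ _ _ _ _ _ HF (taylor2_const (- C1)%cpl))|ring| |];
      reflexivity.
  - reflexivity.
  - ring.
  - ring.
Qed.

Lemma taylor2_log (h : C -> C) (b c : C) :
  cont0 h -> h C0 = C0 -> taylor2 (fun z => Cexp (h z)) C1 b c ->
  taylor2 h C0 b (c - b * b / (C1 + C1))%cpl.
Proof.
  intros Hc H0 He.
  eapply taylor2_eq; [exact (taylor2_uncomp Cexp h _ _ _ _ _ C1_neq_C0 Cexp_taylor2 Hc H0 He)|..].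
  - reflexivity.
  - field; exact C1_neq_C0.
  - rewrite RtoC_div, RtoC_2 by lra; change (RtoC 1) with C1.
    field; split; [exact two_neq_C0|exact C1_neq_C0].
Qed.

(** These are the coefficients of [log (1 + a2 z + a3 z^2 + ...)]. Dividing [Cexp (h z) * z = f z]
    by [z] lowers the order-four remainder of [f] to a cubic error for [Cexp (h z)]; the origin,
    where the equation says nothing, is settled by [h C0 = C0]. *)
Lemma log_quot_taylor2 (f h : C -> C) (a : nat -> C) :
  in_A f a -> log_quot_branch f h ->
  taylor2 h C0 (a 2%nat) (a 3%nat - a 2%nat * a 2%nat / (C1 + C1))%cpl.
Proof.
  intros (a0 & a1 & Hf) (Hh & h0 & Eh).
  destruct (Hh C0 (near0_at _ near0_inU)) as [d Hd].
  apply taylor2_log; [exact (Cderiv_at0_cont0 h d Hd)|exact h0|].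
  destruct (power_series_rem f a 3 Hf) as (K & HK0 & HK).
  apply (taylor2_of_cubic _ _ _ _ K).
  generalize (near0_le (/ 8) ltac:(lra)); apply near0_imp; intros z Hz.
  destruct (C_eq_dec z C0) as [->|Hne].
  - rewrite h0, Cexp_0, Cmod_C0.
    match goal with |- Cmod ?e <= _ => replace e with C0 by ring end.
    rewrite Cmod_C0; right; ring.
  - specialize (HK z Hz); rewrite <- Eh in HK by (trivial; unfold inU; lra).
    cbn [Cpsum Cpow] in HK; rewrite a0, a1 in HK.
    match type of HK with Cmod ?e <= _ => replace e with
      ((Cexp (h z) - (C1 + a 2%nat * z + a 3%nat * (z * z))) * z)%cpl in HK by ring end.
    rewrite Cmod_mul in HK.
    apply (Rmult_le_reg_r (Cmod z)); [apply Cmod_pos, Hne|].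
    eapply Rle_trans; [exact HK|]; right; ring.
Qed.

(** Stated for abstract [b] and [c], so that it covers [f] with [(a2, a3)] as well as [g] with
    [(- a2, 2 a2^2 - a3)]. *)
Lemma Nexpr_taylor2 (lam mu : R) (F' h : C -> C) (b c : C) :
  taylor2 F' C1 ((C1 + C1) * b)%cpl ((C1 + C1 + C1) * c)%cpl ->
  taylor2 h C0 b (c - b * b / (C1 + C1))%cpl ->
  taylor2 (Nexpr lam mu F' h) C1 (RtoC (lam + mu) * b)%cpl
    (RtoC (2 * lam + mu) * (c + (RtoC mu - C1) / (C1 + C1) * (b * b)))%cpl.
Proof.
  intros HF Hh.
  assert (He : forall x, taylor2 (fun z => Cexp (RtoC x * h z))%cpl C1 (RtoC x * b)%cpl
     (RtoC x * (c - b * b / (C1 + C1)) + RtoC x * RtoC x * (b * b) / (C1 + C1))%cpl).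
  { intros x; eapply taylor2_eq.
    - eapply (taylor2_comp Cexp (fun z => RtoC x * h z)%cpl _ _ _ _ _ Cexp_taylor2).
      eapply taylor2_eq; [exact (taylor2_mul _ _ _ _ _ _ _ _ (taylor2_const (RtoC x)) Hh)|ring| |];
        reflexivity.
    - reflexivity.
    - ring.
    - rewrite RtoC_div, RtoC_2 by lra; change (RtoC 1) with C1; field; exact two_neq_C0. }
  unfold Nexpr; eapply taylor2_eq.
  - eapply taylor2_add; eapply taylor2_mul; [apply taylor2_const|apply He|apply taylor2_const|].
    eapply taylor2_mul; [exact HF|apply He].
  - rewrite RtoC_sub; change (RtoC 1) with C1; ring.
  - rewrite RtoC_add, !RtoC_sub; change (RtoC 1) with C1; ring.
  - rewrite RtoC_add, RtoC_mul, !RtoC_sub, RtoC_2; change (RtoC 1) with C1.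
    field; exact two_neq_C0.
Qed.

(** The coefficient comparison after elimination of the first Schwarz coefficient
    [(lam + mu) b / B1]; the factor [B1^2] on the left makes the coefficients of the right side suit
    later addition and subtraction. *)
Lemma subordinate_coef_bound (lam mu : R) (phi F' h : C -> C) (B1 B2 : R) (b c : C) :
  B1 > 0 -> taylor2 phi C1 (RtoC B1) (RtoC B2) ->
  taylor2 F' C1 ((C1 + C1) * b)%cpl ((C1 + C1 + C1) * c)%cpl ->
  taylor2 h C0 b (c - b * b / (C1 + C1))%cpl ->
  subordinate (Nexpr lam mu F' h) phi ->
  exists P, Cmod P <= 1 /\
    (RtoC (B1 * B1) * P)%cpl =
    (RtoC (B1 * (2 * lam + mu)) * (c + (RtoC mu - C1) / (C1 + C1) * (b * b))
     + RtoC ((1 - B2 / B1) * (lam + mu) ^ 2) * (b * b))%cpl.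
Proof.
  intros HB Hphi HF Hh (w & Hw & Hin & w0 & Ew).
  destruct (Hw C0 (near0_at _ near0_inU)) as [d Hd].
  assert (HB0 : RtoC B1 <> C0) by (apply RtoC_neq_C0; lra).
  pose proof (Nexpr_taylor2 lam mu F' h b c HF Hh) as HN.
  apply (taylor2_ext _ (fun z => phi (w z))) in HN.
  2: { generalize near0_inU; apply near0_imp; exact Ew. }
  pose proof (taylor2_uncomp phi w _ _ _ _ _ HB0 Hphi (Cderiv_at0_cont0 w d Hd) w0 HN) as Hu.
  (* Unification fixes the witness: [P = u2 + u1^2] for the coefficients of [w] supplied by [Hu]. *)
  eexists; split; [exact (schwarz_coef2 w _ _ Hw Hin Hu)|].
  simpl pow; rewrite !RtoC_mul, !RtoC_sub, RtoC_div, !RtoC_add, RtoC_mul, RtoC_2 by lra.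
  change (RtoC 1) with C1.
  field; split; [exact HB0|exact two_neq_C0].
Qed.

(** The definition gives [g (f z) = z] near the origin; the identity [f (g w) = w] follows because
    every [w] near [0] is a value of [f] at a small point. The bound [r <= 1] keeps [g w] in the
    disc. *)
Lemma inverse_near (f g : C -> C) (a : nat -> C) :
  in_A f a -> inverse_extension f g ->
  exists r, 0 < r <= 1 /\ (forall z, Cmod z < r -> g (f z) = z) /\
    near0 (fun w => Cmod (g w) < r /\ f (g w) = w).
Proof.
  intros (a0 & a1 & Hf) (_ & r & Hr & Hgf).
  exists (Rmin r 1); split; [split; [apply Rmin_pos; lra|apply Rmin_r]|].
  pose proof (Rmin_l r 1).
  assert (Hgf' : forall z, Cmod z < Rmin r 1 -> g (f z) = z) by (intros; apply Hgf; lra).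
  split; [exact Hgf'|].
  generalize (power_series_local_onto f a (Rmin r 1) Hf a0 a1 ltac:(apply Rmin_pos; lra)).
  apply near0_imp; intros w (z & Hz & <-); rewrite Hgf' by exact Hz; split; trivial.
Qed.

Lemma inverse_taylor2 (f g : C -> C) (a : nat -> C) :
  in_A f a -> inverse_extension f g -> taylor2 g C0 C1 (- a 2%nat)%cpl.
Proof.
  intros HA HI; destruct (inverse_near f g a HA HI) as (r & Hr & Hgf & Hfg).
  destruct HA as (a0 & a1 & Hf); destruct HI as ((Hg & _) & _).
  pose proof (power_series_taylor2 f a Hf) as Tf; rewrite a0, a1 in Tf.
  destruct (Hg C0 (near0_at _ near0_inU)) as [d Hd].
  assert (g0 : g C0 = C0).
  { rewrite <- a0 at 1; rewrite <- (power_series_at0 f a Hf); apply Hgf; rewrite Cmod_C0; lra. }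
  eapply taylor2_eq.
  - apply (taylor2_uncomp f g _ _ _ C1 C0 C1_neq_C0 Tf (Cderiv_at0_cont0 g d Hd) g0).
    generalize taylor2_id; apply taylor2_ext.
    generalize Hfg; apply near0_imp; intros w [_ E]; symmetry; exact E.
  - reflexivity.
  - field; exact C1_neq_C0.
  - field; exact C1_neq_C0.
Qed.

(** The second coefficient of [g'] involves the third one of [g], which the order-two expansion of
    [g] does not contain. The chain rule gives [g' w = 1 / f' (g w)] near [0], and for this
    expression order two of [g] is enough. *)
Lemma inverse_deriv_taylor2 (f f' g g' : C -> C) (a : nat -> C) :
  in_A f a -> inverse_extension f g -> deriv_on_U f f' -> deriv_on_U g g' ->
  taylor2 g' C1 ((C1 + C1) * - a 2%nat)%cpl
    ((C1 + C1 + C1) * ((C1 + C1) * (a 2%nat * a 2%nat) - a 3%nat))%cpl.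
Proof.
  intros HA HI Hf' Hg'.
  pose proof (inverse_taylor2 f g a HA HI) as Tg.
  destruct (inverse_near f g a HA HI) as (r & Hr & Hgf & Hfg).
  destruct HA as (a0 & a1 & Hf).
  pose proof (power_series_deriv_taylor2 f f' a Hf Hf') as Tf'.
  rewrite a1, RtoC_2, RtoC_3 in Tf'.
  pose proof (taylor2_inv _ _ _ (taylor2_comp f' g _ _ _ _ _ Tf' Tg)) as Ti.
  eapply taylor2_eq.
  - eapply taylor2_ext; [|exact Ti].
    generalize (near0_and _ _ Hfg near0_inU); apply near0_imp; intros w [[Hz E] Hw].
    set (z := g w) in *.
    assert (Hz1 : inU z) by (unfold inU; lra).
    assert (D : Cderiv (fun y => g (f y)) z (g' w * f' z)%cpl).
    { apply Cderiv_comp; [apply Hf', Hz1|rewrite E; apply Hg', Hw]. }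
    assert (D1 : Cderiv (fun y => g (f y)) z C1).
    { generalize (Cderiv_id z); apply Cderiv_ext.
      exists (r - Cmod z); split; [lra|]; intros u Hu.
      symmetry; apply Hgf; eapply Rle_lt_trans; [apply Cmod_add_le|lra]. }
    pose proof (Cderiv_unique _ _ _ _ D D1) as Eq.
    assert (Hn : f' z <> C0).
    { intros H0; rewrite H0 in Eq; apply C1_neq_C0; rewrite <- Eq; ring. }
    transitivity (C1 * / f' z)%cpl; [ring|rewrite <- Eq; field; exact Hn].
  - reflexivity.
  - ring.
  - ring.
Qed.

(** The same difficulty as for [g'], met by [log (g w / w) = - log (f z / z)] at [z = g w]. The sum
    [hg w + hf (g w)] has exponential [1] near the origin and vanishes at it, so its expansion is
    zero, and that of [hg] is the opposite of that of [hf o g]. *)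
Lemma inverse_log_quot_taylor2 (f g hf hg : C -> C) (a : nat -> C) :
  in_A f a -> inverse_extension f g -> log_quot_branch f hf -> log_quot_branch g hg ->
  taylor2 hg C0 (- a 2%nat)%cpl
    ((C1 + C1) * (a 2%nat * a 2%nat) - a 3%nat - - a 2%nat * - a 2%nat / (C1 + C1))%cpl.
Proof.
  intros HA HI Hhf Hhg.
  pose proof (inverse_taylor2 f g a HA HI) as Tg.
  destruct (inverse_near f g a HA HI) as (r & Hr & _ & Hfg).
  pose proof (log_quot_taylor2 f hf a HA Hhf) as Th.
  pose proof (taylor2_comp hf g _ _ _ _ _ Th Tg) as Tc.
  destruct Hhf as (_ & hf0 & Ehf); destruct Hhg as (Dhg & hg0 & Ehg).
  destruct (Dhg C0 (near0_at _ near0_inU)) as [d Hd].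
  pose proof (Cderiv_at0_cont0 hg d Hd) as Chg.
  assert (g0 : g C0 = C0) by exact (taylor2_at0 _ _ _ _ Tg).
  assert (Ts : taylor2 (fun w => hg w + hf (g w))%cpl C0 C0 C0).
  { eapply taylor2_eq.
    - apply (taylor2_log _ C0 C0).
      + apply cont0_add; [exact Chg|exact (taylor2_cont0 _ _ _ _ Tc)].
      + rewrite hg0, g0, hf0; ring.
      + generalize (taylor2_const C1); apply taylor2_ext.
        generalize (near0_and _ _ Hfg near0_inU); apply near0_imp; intros w [[Hz E] Hw].
        rewrite Cexp_add.
        destruct (C_eq_dec w C0) as [->|Hne].
        * rewrite g0, hg0, hf0, Cexp_0; ring.
        * assert (Hgn : g w <> C0).
          { intros Hg; apply Hne; rewrite <- E, Hg.
            destruct (near0_at _ Hfg) as [_ E0]; rewrite g0 in E0; exact E0. }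
          assert (H1 : (Cexp (hf (g w)) * g w)%cpl = w).
          { rewrite Ehf; [exact E| |exact Hgn]; unfold inU; lra. }
          rewrite <- (Ehg w Hw Hne) in H1 at 2.
          transitivity (w * / w)%cpl; [field; exact Hne|].
          rewrite <- H1 at 1; field; exact Hne.
    - reflexivity.
    - reflexivity.
    - field; exact two_neq_C0. }
  eapply taylor2_eq.
  - eapply (taylor2_ext (fun w => (hg w + hf (g w)) + - C1 * hf (g w))%cpl).
    { exists 1; split; [lra|]; intros; ring. }
    eapply taylor2_add; [exact Ts|].
    exact (taylor2_mul _ _ _ _ _ _ _ _ (taylor2_const (- C1)%cpl) Tc).
  - ring.
  - ring.
  - field; exact two_neq_C0.
Qed.

(** * Combination of the two relations and final estimate *)

Lemma RtoC_scale_eq (p q : R) (X Y : C) :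
  p <> 0 -> (RtoC p * X)%cpl = (RtoC q * Y)%cpl -> X = (RtoC (q / p) * Y)%cpl.
Proof.
  intros Hp E; assert (Hp0 : RtoC p <> C0) by (apply RtoC_neq_C0, Hp).
  rewrite RtoC_div by exact Hp.
  transitivity (RtoC p * X / RtoC p)%cpl; [field; exact Hp0|].
  rewrite E; field; exact Hp0.
Qed.

Lemma Cmod_comb_le (h k : R) (P Q : C) :
  Cmod P <= 1 -> Cmod Q <= 1 -> 0 <= k ->
  Cmod (RtoC k * (P - Q) + RtoC h * (P + Q))%cpl <= 2 * Rmax (Rabs h) k.
Proof.
  intros HP HQ Hk.
  replace (RtoC k * (P - Q) + RtoC h * (P + Q))%cpl
    with (RtoC (h + k) * P + RtoC (h - k) * Q)%cpl by (rewrite RtoC_add, RtoC_sub; ring).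
  eapply Rle_trans; [apply Cmod_add_le|]; rewrite !Cmod_mul, !Cmod_RtoC.
  pose proof (Rabs_pos (h + k)); pose proof (Rabs_pos (h - k)).
  apply Rle_trans with (Rabs (h + k) + Rabs (h - k)); [nra|].
  unfold Rmax, Rabs; destruct Rle_dec; repeat destruct Rcase_abs; lra.
Qed.

Theorem theorem2p1 (lam mu : R) (phi : C -> C) (B : nat -> R)
  (f : C -> C) (a : nat -> C) (delta : R) :
  lam >= 1 -> mu >= 0 ->
  phi_hyp phi B ->
  in_N_Sigma mu lam phi f a ->
  let B1 := B 1%nat in
  let B2 := B 2%nat in
  let D := (2 * lam + mu) * (1 + mu) * B1 ^ 2 + 2 * (B1 - B2) * (lam + mu) ^ 2 in
  let K := (mu + 1) / 2 *
    Rabs (1 + 2 * (B1 - B2) * (lam + mu) ^ 2 / (B1 ^ 2 * (2 * lam + mu) * (1 + mu))) in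
  let E := Cmod (Csub (a 3%nat) (Cmul (RtoC delta) (Cmul (a 2%nat) (a 2%nat)))) in
  D <> 0 ->
  (Rabs (delta - 1) <= K -> E <= B1 / (2 * lam + mu)) /\
  (Rabs (delta - 1) >= K -> E <= 2 * B1 ^ 3 * Rabs (delta - 1) / Rabs D).
Proof.
  intros Hlam Hmu (_ & Hphi & B0 & HB1 & _)
    (HA & _ & g & f' & g' & hf & hg & HI & Hf' & Hg' & Hhf & Hhg & Sf & Sg) B1 B2 D K E HD.
  fold B1 in HB1.
  assert (Tphi : taylor2 phi C1 (RtoC B1) (RtoC B2)).
  { pose proof (power_series_taylor2 _ _ Hphi) as T; cbn beta in T; rewrite B0 in T; exact T. }
  assert (Tf' : taylor2 f' C1 ((C1 + C1) * a 2%nat)%cpl ((C1 + C1 + C1) * a 3%nat)%cpl).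
  { destruct HA as (_ & a1 & Hf); pose proof (power_series_deriv_taylor2 f f' a Hf Hf') as T.
    rewrite a1, RtoC_2, RtoC_3 in T; exact T. }
  destruct (subordinate_coef_bound lam mu phi f' hf B1 B2 _ _ HB1 Tphi Tf'
    (log_quot_taylor2 f hf a HA Hhf) Sf) as (P & HP & EP).
  destruct (subordinate_coef_bound lam mu phi g' hg B1 B2 _ _ HB1 Tphi
    (inverse_deriv_taylor2 f f' g g' a HA HI Hf' Hg')
    (inverse_log_quot_taylor2 f g hf hg a HA HI Hhf Hhg) Sg) as (Q & HQ & EQ).
  set (x := (a 2%nat * a 2%nat)%cpl) in *.
  replace (- a 2%nat * - a 2%nat)%cpl with x in EQ by (unfold x; ring).
  assert (Hs : 2 * lam + mu > 0) by lra.
  assert (HB1C : RtoC B1 <> C0) by (apply RtoC_neq_C0; lra).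
  (* The relations for [f] and [g] share all terms in [b^2 = a2^2], so these cancel in the
     difference; there remains [a3 - (2 a2^2 - a3) = 2 (a3 - a2^2)]. *)
  assert (E1 : (a 3%nat - x)%cpl = (RtoC (B1 / (2 * (2 * lam + mu))) * (P - Q))%cpl).
  { assert (G : (RtoC (B1 * (2 * (2 * lam + mu))) * (a 3%nat - x))%cpl
                = (RtoC (B1 * B1) * (P - Q))%cpl).
    { replace (RtoC (B1 * B1) * (P - Q))%cpl
        with (RtoC (B1 * B1) * P - RtoC (B1 * B1) * Q)%cpl by ring.
      rewrite EP, EQ, !RtoC_mul, RtoC_2; field; exact two_neq_C0. }
    replace (B1 / (2 * (2 * lam + mu))) with (B1 * B1 / (B1 * (2 * (2 * lam + mu)))) by (field; lra).
    apply RtoC_scale_eq; [nra|exact G]. }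
  (* In the sum [a3] disappears, since [a3 + (2 a2^2 - a3) = 2 a2^2]; after multiplication by [B1]
     the total coefficient of [a2^2] is [D]. *)
  assert (E2 : x = (RtoC (B1 ^ 3 / D) * (P + Q))%cpl).
  { apply RtoC_scale_eq; [exact HD|].
    replace (RtoC (B1 ^ 3) * (P + Q))%cpl
      with (RtoC B1 * (RtoC (B1 * B1) * P + RtoC (B1 * B1) * Q))%cpl
      by (simpl pow; rewrite Rmult_1_r, !RtoC_mul; ring).
    rewrite EP, EQ; unfold D; simpl pow; rewrite !Rmult_1_r.
    rewrite !RtoC_add, !RtoC_mul, !RtoC_sub, RtoC_div, !RtoC_add, !RtoC_mul, RtoC_2 by lra.
    change (RtoC 1) with C1.
    field; split; [exact HB1C|exact two_neq_C0]. }
  set (k := B1 / (2 * (2 * lam + mu))) in *.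
  set (h := (1 - delta) * (B1 ^ 3 / D)).
  assert (Hk : 0 < k) by (apply Rdiv_lt_0_compat; lra).
  assert (HE : E <= 2 * Rmax (Rabs h) k).
  { unfold E.
    replace (a 3%nat - RtoC delta * x)%cpl
      with (RtoC k * (P - Q) + RtoC h * (P + Q))%cpl.
    - apply Cmod_comb_le; trivial; lra.
    - unfold h; rewrite <- E1, RtoC_mul, RtoC_sub; change (RtoC 1) with C1.
      replace ((C1 - RtoC delta) * RtoC (B1 ^ 3 / D) * (P + Q))%cpl
        with ((C1 - RtoC delta) * (RtoC (B1 ^ 3 / D) * (P + Q)))%cpl by ring.
      rewrite <- E2; ring. }
  assert (HDp : 0 < Rabs D) by (apply Rabs_pos_lt, HD).
  assert (HB3 : 0 < B1 ^ 3) by (apply pow_lt; lra).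
  assert (Hh : Rabs h = Rabs (delta - 1) * B1 ^ 3 / Rabs D).
  { unfold h; unfold Rdiv; rewrite !Rabs_mult, Rabs_inv, (Rabs_minus_sym 1), (Rabs_right (B1 ^ 3)) by lra.
    ring. }
  assert (HK : K = Rabs D / (2 * B1 ^ 2 * (2 * lam + mu))).
  { unfold K.
    replace (1 + _) with (D / (B1 ^ 2 * (2 * lam + mu) * (1 + mu))) by (unfold D; field; nra).
    assert (0 < B1 ^ 2 * (2 * lam + mu) * (1 + mu)).
    { apply Rmult_lt_0_compat; [apply Rmult_lt_0_compat|]; try lra; apply pow_lt; lra. }
    unfold Rdiv at 2; rewrite Rabs_mult, Rabs_inv, (Rabs_right (B1 ^ 2 * _ * _)) by lra.
    field; nra. }
  (* With [|h| = |delta - 1| B1^3 / |D|], comparing [|delta - 1|] with [K] amounts to comparing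
     [|h|] with [k]: the two cases of the theorem are the two values of the maximum, [2 k] and
     [2 |h|]. *)
  assert (Ek : k = K * B1 ^ 3 / Rabs D).
  { rewrite HK; unfold k; field; nra. }
  split; intros Hd.
  - assert (Rabs h <= k).
    { rewrite Hh, Ek; apply Rmult_le_compat_r; [left; apply Rinv_0_lt_compat, HDp|].
      apply Rmult_le_compat_r; lra. }
    rewrite Rmax_right in HE by assumption.
    eapply Rle_trans; [exact HE|]; right; unfold k; field; lra.
  - assert (k <= Rabs h).
    { rewrite Hh, Ek; apply Rmult_le_compat_r; [left; apply Rinv_0_lt_compat, HDp|].
      apply Rmult_le_compat_r; lra. }
    rewrite Rmax_left in HE by assumption.
    eapply Rle_trans; [exact HE|]; right; rewrite Hh; field; lra.
Qed.
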